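(* Suppose the parallel server system satisfies the relaxed heavy traffic condition and the relaxed complete resource pooling condition. Let $(v,u)$ be the unique optimal solution of the dual LP. Then, under the WWTA routing policy and any non-idling scheduling policy $\mathcal{P}$, as $r\downarrow 0$, $$ r\Big(W_1\big(Z^{(r)}\big),\ldots,W_K\big(Z^{(r)}\big)\Big)\ \stackrel{d}{\longrightarrow}\ (u_1,\ldots,u_K)\,X ,$$ where $X$ is a (one-dimensional) exponentially distributed random variable with mean $$\frac{\sum_{i=1}^{I}\lambda_i v_i^2}{\sum_{k=1}^{K}u_k^2}.$$ In particular the scaled workload $rW_k(Z^{(r)})$ of each server converges in distribution to an exponential random variable.
   Context: Model. Job classes $\mathcal{I}=\{1,\ldots,I\}$, servers $\mathcal{K}=\{1,\ldots,K\}$, and a set $\mathcal{J}\subset\mathcal{I}\times\mathcal{K}$ of $J$ activities ($(i,k)\in\mathcal{J}$ means server $k$ can process class $i$). $\mathcal{I}(k)=\{i:(i,k)\in\mathcal{J}\}$, $\mathcal{K}(i)=\{k:(i,k)\in\mathcal{J}\}$. Class $i$ has nominal arrival rate $\lambda_i>0$ (Poisson arrivals); service times for activity $(i,k)$ are exponential with mean $m_{ik}=1/\mu_{ik}$, $\mu_{ik}>0$. LP (static allocation problem): minimize $\rho$ over $x=(x_{ik})_{(i,k)\in\mathcal{J}}\ge 0$, $\rho\ge0$, subject to $\sum_{k\in\mathcal{K}(i)}\mu_{ik}x_{ik}=\lambda_i$ for all $i$, and $\sum_{i\in\mathcal{I}(k)}x_{ik}\le\rho$ for all $k$. Dual LP: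 maximize $\sum_i\lambda_iv_i$ over $v\in\mathbb{R}^I$, $u\in\mathbb{R}^K$, $u\ge0$, subject to $\mu_{ik}v_i\le u_k$ for all $(i,k)\in\mathcal{J}$ and $\sum_ku_k\le1$. Relaxed heavy traffic condition: the LP has an optimal solution $(x^*,\rho^* )$ (not necessarily unique) with $\rho^*=1$ and $\sum_{i\in\mathcal{I}(k)}x^*_{ik}=1$ for every $k$. Activity $(i,k)$ is basic associated with such an $x^*$ if $x^*_{ik}>0$. Servers $k,k'$ communicate directly if for some such $x^*$ and some class $i$ both $(i,k)$ and $(i,k')$ are basic activities associated with $x^*$; servers $k,k'$ communicate if there is a sequence $k=k_1,\ldots,k_\omega=k'$ with consecutive servers communicating directly. Relaxed complete resource pooling condition: such an $x^*$ exists and all servers communicate (different links may use different optimal $x^*$). Under these two conditions the dual LP has a unique optimal solution $(v,u)$, with all $u_k>0$, $v_i>0$. Policies. A state is $z=(z_{ik})_{(i,k)\in\mathcal{J}}\in\mathbb{Z}_+^J$, $z_{ik}$ being the number of jobs in buffer $(i,k)$ (including in service). Workload: $W_k(z)=\sum_{i\in\mathcal{I}(k)}m_{ik}z_{ik}$. WWTA routing: a class $i$ arrival in state $z$ is immediately routed to server $L^{(i)}(z)$, the smallest index in $\arg\min_{k\in\mathcal{K}(i)}m_{ik}W_k(z)$. A non-idling scheduling policy $\mathcal{P}=(P_{ik}(z))$ gives the fraction $P_{ik}(z)\in[0,1]$ of effort of server $k$ devoted to class $i$ in state $z$, with $P_{ik}(z)=0$ if $z_{ik}=0$ and $\sum_{i\in\mathcal{I}(k)}P_{ik}(z)=1$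 whenever $\sum_{i\in\mathcal{I}(k)}z_{ik}>0$. Sequence of systems. For $r\in(0,1)$, the $r$th system has arrival rates $\lambda_i^{(r)}=\lambda_i(1-r)$, other parameters unchanged. Its queue length process is the continuous-time Markov chain on $\mathbb{Z}_+^J$ with generator $$Gf(z)=\sum_{i}\lambda_i^{(r)}\sum_{k\in\mathcal{K}(i)}[f(z+e_{ik})-f(z)]\mathbf{1}(k=L^{(i)}(z))+\sum_k\sum_{i\in\mathcal{I}(k)}\mu_{ik}P_{ik}(z)[f(z-e_{ik})-f(z)],$$ $e_{ik}$ the unit vectors. For each $r\in(0,1)$ it has a unique stationary distribution; $Z^{(r)}$ denotes a random vector with this distribution. *)

(* Defs.v *)
From HB Require Import structures.
From mathcomp Require Import all_boot all_order all_algebra.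
From mathcomp Require Import all_classical all_reals all_analysis.
From Stdlib Require Import Relation_Operators.

Set Implicit Arguments.
Unset Strict Implicit.
Unset Printing Implicit Defensive.

Import Order.TTheory GRing.Theory Num.Theory.
Import numFieldNormedType.Exports.

Local Open Scope classical_set_scope.
Local Open Scope ring_scope.

Record parallel_server_system (R : realType) (nI nK : nat) :=
  ParallelServerSystem {
    activities : {set 'I_nI * 'I_nK} ;
    arrival_rate : 'I_nI -> R ;
    service_rate : {a : 'I_nI * 'I_nK | a \in activities} -> R ;
    arrival_rate_gt0 : forall i, 0 < arrival_rate i ;
    service_rate_gt0 : forall a, 0 < service_rate a }.

Section model.
Context {R : realType} {nI nK : nat}.
Variable S : parallel_server_system R nI nK.

Definition activity := {a : 'I_nI * 'I_nK | a \in activities S}.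

Definition job_class (a : activity) : 'I_nI := (val a).1.
Definition server (a : activity) : 'I_nK := (val a).2.

Definition mean_service (a : activity) : R := (service_rate a)^-1.

(* Sums over k in K(i) (resp. i in I(k)) are sums over the activities of class
   i (resp. server k). *)

Definition lp_feasible (x : activity -> R) (rho : R) : Prop :=
  [/\ forall a, 0 <= x a,
      0 <= rho,
      forall i, \sum_(a | job_class a == i) service_rate a * x a
                = arrival_rate S i
    & forall k, \sum_(a | server a == k) x a <= rho].

Definition lp_optimal (x : activity -> R) (rho : R) : Prop :=
  lp_feasible x rho /\
  forall x' rho', lp_feasible x' rho' -> rho <= rho'.

Definition dual_feasible (v : 'I_nI -> R) (u : 'I_nK -> R) : Prop :=
  [/\ forall k, 0 <= u k,
      forall a : activity, service_rate a * v (job_class a) <= u (server a)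
    & \sum_k u k <= 1].

Definition dual_optimal (v : 'I_nI -> R) (u : 'I_nK -> R) : Prop :=
  dual_feasible v u /\
  forall v' u', dual_feasible v' u' ->
    \sum_i arrival_rate S i * v' i <= \sum_i arrival_rate S i * v i.

Definition heavy_traffic_solution (x : activity -> R) : Prop :=
  lp_optimal x 1 /\ forall k, \sum_(a | server a == k) x a = 1.

Definition relaxed_heavy_traffic : Prop :=
  exists x, heavy_traffic_solution x.

Definition basic (x : activity -> R) (a : activity) : Prop := 0 < x a.

Definition communicate_directly (k k' : 'I_nK) : Prop :=
  exists x : activity -> R, heavy_traffic_solution x /\
  exists a a' : activity,
    [/\ job_class a = job_class a', server a = k, server a' = k',
        basic x a & basic x a'].

Definition communicate (k k' : 'I_nK) : Prop :=
  clos_refl_trans 'I_nK communicate_directly k k'.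

Definition relaxed_complete_resource_pooling : Prop :=
  relaxed_heavy_traffic /\ forall k k', communicate k k'.

Definition state := {ffun activity -> nat}.

HB.instance Definition _ := Countable.on state.
HB.instance Definition _ := isPointed.Build state [ffun=> 0%N].
HB.instance Definition _ := @isMeasurable.Build default_measure_display
  state discrete_measurable discrete_measurable0
  discrete_measurableC discrete_measurableU.

Definition workload (z : state) (k : 'I_nK) : R :=
  \sum_(a | server a == k) mean_service a * (z a)%:R.

Definition in_argmin (z : state) (a : activity) : bool :=
  [forall b : activity, (job_class b == job_class a) ==>
     (mean_service a * workload z (server a)
      <= mean_service b * workload z (server b))].

(* For a = (i, k): k is the smallest index in the argmin, i.e. k = L^(i)(z). *)
Definition wwta (z : state) (a : activity) : bool :=
  in_argmin z a &&
  [forall b : activity, (job_class b == job_class a) && in_argmin z b ==>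
     (server a <= server b)%N].

(* [P z a] is the fraction of effort that [server a] devotes to
   [job_class a]. *)
Definition nonidling_policy (P : state -> activity -> R) : Prop :=
  [/\ forall (z : state) a, 0 <= P z a <= 1,
      forall (z : state) a, z a = 0%N -> P z a = 0
    & forall (z : state) k, (0 < \sum_(a | server a == k) z a)%N ->
        \sum_(a | server a == k) P z a = 1].

Definition add_job (z : state) (a : activity) : state :=
  [ffun b => (z b + (b == a))%N].

(* The truncated subtraction is harmless: departures from an empty buffer
   have rate 0. *)
Definition remove_job (z : state) (a : activity) : state :=
  [ffun b => (z b - (b == a))%N].

Definition scaled_arrival_rate (r : R) (i : 'I_nI) : R :=
  arrival_rate S i * (1 - r).

Definition generator (P : state -> activity -> R) (r : R) (f : state -> R)
    (z : state) : R :=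
  \sum_i scaled_arrival_rate r i *
    (\sum_(a | job_class a == i) (f (add_job z a) - f z) * (wwta z a)%:R)
  + \sum_k \sum_(a | server a == k)
      service_rate a * P z a * (f (remove_job z a) - f z).

(* The transition rates are bounded, so the transition semigroup of the chain
   is exp (t G) = \sum_n t^n / n! G^n, a norm-convergent series on bounded
   functions. *)
Definition transition_semigroup (P : state -> activity -> R) (r t : R)
    (f : state -> R) (z : state) : R :=
  limn (series (fun n => t ^+ n / n`!%:R * iter n (generator P r) f z)).

Definition stationary_distribution (P : state -> activity -> R) (r : R)
    (pi : probability state R) : Prop :=
  forall (t : R) (f : state -> R), 0 <= t -> bounded_fun f ->
    ('E_pi[transition_semigroup P r t f] = 'E_pi[f])%E.

End model.

Definition cvg_in_distribution {R : realType} {I : Type} (F : set_system I)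
    {V : topologicalType}
    {d : I -> measure_display} {Omega : forall i, measurableType (d i)}
    (P : forall i, probability (Omega i) R) (X : forall i, Omega i -> V)
    {d' : measure_display} {Omega' : measurableType d'}
    (P' : probability Omega' R) (Y : Omega' -> V) : Prop :=
  forall f : V -> R, continuous f -> bounded_fun f ->
    ('E_(P i)[fun w => f (X i w)] @[i --> F] --> 'E_P'[fun w => f (Y w)])%E.

(* [exponential_prob] takes the rate; it is a probability measure only for a
   positive rate, so the definition forces [0 < mean]. *)
Definition exponential_with_mean {R : realType} {d : measure_display}
    {Omega : measurableType d} (P : probability Omega R) (X : Omega -> R)
    (mean : R) : Prop :=
  forall A : set R, measurable A ->
    P (X @^-1` A) = exponential_prob mean^-1 A.

(* Main.v *)
(* For a stationary law of the chain, E[G f] = 0 for bounded f, and applying this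
   to exp (- eps V) with eps -> 0 turns a drift bound G V <= - phi + C into
   E phi <= C.

   Let (v, u) be the dual solution, Y = sum_k u_k W_k, and let T be the l1 norm of
   the component of W orthogonal to u.  Dual feasibility gives
   m_ik u_k >= v_i, with equality on basic activities by complementary slackness.  Taking V = |W|^2 bounds
   r E Y.  By complete resource pooling T is at most a constant times the gap in
   the drift of |W|^2 created by the WWTA rule, so the fourth power of the
   orthogonal component yields E T^2 = O(1): the workload collapses onto the line
   spanned by u.

   The drift of Y is - r + eta, where eta >= 0 collects idleness and arrivals routed
   to activities with m_ik u_k > v_i; it vanishes unless Y <= C T, and E eta = r.
   The test function F = prod_a (1 + s r y_a) ^ (- z_a), with y_a = m_ik u_k, satisfies
     G F = s r F (r - eta + s r (sum_i lambda_i v_i^2 + small error)),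
   while E[(1 - F) eta] = o(r), so E F -> 1 / (1 + s sum_i lambda_i v_i^2).  Since
   F is close to exp (- s r Y), this is convergence of Laplace transforms to that of
   an exponential variable, which implies convergence in distribution. *)

Require Import Defs.
From HB Require Import structures.
From mathcomp Require Import all_boot all_order all_algebra.
From mathcomp Require Import all_classical all_reals all_analysis.
From mathcomp Require Import measurable_realfun.
From mathcomp Require Import ring lra.
Set Implicit Arguments.
Unset Strict Implicit.
Unset Printing Implicit Defensive.

Import Order.TTheory GRing.Theory Num.Theory.
Import numFieldNormedType.Exports.
Local Open Scope classical_set_scope.
Local Open Scope ring_scope.

(** * Weierstrass approximation and Laplace transforms *)

(** The identity E eta = r cannot be read off from [G Y], because Y is unbounded; it comes from the
    same test functions F, by letting their parameter tend to 0 while [r] stays fixed. The second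
    moment of T is what makes E[(1 - F) eta] = o(r). Where eta is nonzero, 1 - F is at most a
    constant times r T, so E[T eta] must tend to 0. As eta is bounded with mean r, the inequality T
    eta <= q T^2 + eta^2 / q with q = sqrt r gives a bound of order q. A bound on E T alone would
    leave E[T eta] of order 1. Complementary slackness rests on strong duality of the allocation LP,
    obtained here from near-minimizers of the squared overload of the servers. In the passage from
    Laplace transforms to weak convergence, bounded continuous functions are approximated by
    polynomials in exp (- del x). The approximation is poor for large x, but its mean error is again
    a Laplace transform, small for small del; this plays the part of tightness. *)

Lemma continuous_near_compact (R : realType) (V : pseudoMetricType R)
    (f : V -> R) (C : set V) (e : R) :
  continuous f -> compact C -> 0 < e ->
  exists2 delta : R, 0 < delta &
    forall c x, C c -> ball c delta x -> `|f x - f c| <= e.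
Proof.
move=> cf /compact_near_coveringP cC e0.
suff [delta delta0 H] : exists2 d : R, 0 < d & forall c, C c ->
    forall x, ball c d x -> `|f x - f c| <= e.
  by exists delta => // c x Cc; exact: H.
have : \forall d \near 0^'+, C `<=` (fun c => forall x, ball c d x -> `|f x - f c| <= e).
  apply: cC => c Cc.
  have /cvgrPdist_lt /(_ (e / 2)) := cf c.
  rewrite divr_gt0// => /(_ isT) /nbhs_ballP[d /= d0 dP].
  exists (ball c (d / 2), [set y | 0 < y < d / 2]) => /=.
    split; first by apply: nbhsx_ballx; rewrite divr_gt0.
    near=> y; apply/andP; split; first by near: y; exact: nbhs_right_gt.
    by near: y; apply: nbhs_right_lt; rewrite divr_gt0.
  move=> [c' y] /= [cc' /andP[y0 yd]] x c'x.
  have h1 : `|f c - f c'| < e / 2.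
    apply: dP; apply: le_ball cc'; lra.
  have h2 : `|f c - f x| < e / 2.
    apply: dP; rewrite (splitr d); apply: (ball_triangle cc').
    by apply: le_ball c'x; exact: ltW.
  have -> : f x - f c' = (f c - f c') - (f c - f x) by ring.
  by apply: (le_trans (ler_normB _ _)); lra.
case=> d /= d0 H.
exists (d / 2); first by rewrite divr_gt0.
move=> c Cc x cx; apply: (H (d / 2)) => //=; last by rewrite divr_gt0.
rewrite /ball/= sub0r normrN gtr0_norm ?divr_gt0//; lra.
Unshelve. all: by end_near. Qed.

Section bernstein.
Context {R : realType}.
Implicit Types (x c : R) (phi : nat -> R).

(* One step of a Bernoulli random walk: [iter n (bernoulli_step x) phi 0] is the
   mean of [phi] at a binomial variable with parameters [n] and [x], so with
   [phi k = h (k / n)] it is the Bernstein polynomial of [h] at [x]. *)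
Definition bernoulli_step x phi (k : nat) : R :=
  x * phi k.+1 + (1 - x) * phi k.

Lemma bernoulli_step_le x phi psi : 0 <= x <= 1 ->
  (forall k, phi k <= psi k) ->
  forall n k, iter n (bernoulli_step x) phi k <= iter n (bernoulli_step x) psi k.
Proof.
move=> /andP[x0 x1] H; elim=> [|n IH] k //=.
by apply: lerD; apply: ler_wpM2l => //; rewrite subr_ge0.
Qed.

Lemma bernoulli_step_affine x phi (a b : R) n k :
  iter n (bernoulli_step x) (fun j => a + b * phi j) k =
  a + b * iter n (bernoulli_step x) phi k.
Proof.
by elim: n k => [|n IH] k //=; rewrite /bernoulli_step !IH; ring.
Qed.

Lemma bernoulli_step_variance x c n k :
  iter n (bernoulli_step x) (fun j => (j%:R - c) ^+ 2) k =
  (k%:R - c + n%:R * x) ^+ 2 + n%:R * (x - x ^+ 2).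
Proof.
elim: n k => [|n IH] k /=; first by ring.
by rewrite /bernoulli_step !IH -!(natr1 _); ring.
Qed.

Definition bernstein (h : R -> R) (n : nat) : {poly R} :=
  iter n (fun p k => 'X * p k.+1 + (1 - 'X) * p k) (fun k => (h (Num.min 1 (k%:R / n%:R)))%:P) 0%N.

Lemma horner_bernstein h n x : (bernstein h n).[x] =
  iter n (bernoulli_step x) (fun k => h (Num.min 1 (k%:R / n%:R))) 0%N.
Proof.
rewrite /bernstein; elim: {1 3}n 0%N => [|m IH] k /=; first by rewrite hornerC.
by rewrite !hornerE !IH.
Qed.

(** Bernstein's argument: the pointwise error is at most [e / 2] plus a multiple of the squared
    distance from the node to [x], and the binomial mean of that square is [(x - x ^+ 2) / n]. *)
Lemma weierstrass (h : R -> R) (e : R) : continuous h -> 0 < e ->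
  exists p : {poly R}, forall x, 0 <= x <= 1 -> `|h x - p.[x]| <= e.
Proof.
move=> ch e0.
have e2 : 0 < e / 2 by lra.
have [d d0 dP] := continuous_near_compact ch (@segment_compact R 0 1) e2.
have [M M0 MP] : exists2 M : R, 0 < M & forall x, 0 <= x <= 1 -> `|h x| <= M.
  have [M [_ H]] := @compact_bounded R R (h @` `[0, 1])
    (continuous_compact (continuous_subspaceT ch) (@segment_compact R 0 1)).
  exists (`|M| + 1) => [|x x01]; first by rewrite ltr_wpDl.
  by apply: (H (`|M| + 1)) => [|/=]; [rewrite ltr_pwDr// ler_norm|
    exists x => //=; rewrite in_itv].
(* With this [K], the term [K * (y - x) ^+ 2] exceeds the trivial bound [2 * M] as soon as [y] is at
   distance at least [d] from [x]. *)
pose K := 2 * M / d ^+ 2.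
have K0 : 0 <= K by rewrite /K divr_ge0 ?mulr_ge0 ?exprn_ge0 ?ltW.
have hK x z : 0 <= x <= 1 -> 0 <= z ->
    `|h x - h (Num.min 1 z)| <= e / 2 + K * (z - x) ^+ 2.
  move=> /andP[x0 x1] z0.
  (* Since [x <= 1], capping the node at 1 only brings it closer to [x]. *)
  have [y y01 [-> yz]] : exists2 y : R, 0 <= y <= 1 &
      Num.min 1 z = y /\ (y - x) ^+ 2 <= (z - x) ^+ 2.
    exists (Num.min 1 z); first by rewrite ge_min lexx /= le_min ler01 z0.
    by split=> //; rewrite /Num.min; case: ifPn => // z1; nra.
  apply: (@le_trans _ _ (e / 2 + K * (y - x) ^+ 2)); last first.
    by rewrite lerD2l ler_wpM2l.
  have [dxy|dxy] := ltP `|y - x| d.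
    rewrite distrC; apply: (@le_trans _ _ (e / 2)).
      by apply: dP; [rewrite /= in_itv/= x0|rewrite /ball/= distrC].
    by rewrite lerDl mulr_ge0// sqr_ge0.
  apply: (@le_trans _ _ (2 * M)).
    apply: (le_trans (ler_normB _ _)).
    have := MP y y01; have := MP x; rewrite x0 x1 => /(_ isT); lra.
  have H : d ^+ 2 <= (y - x) ^+ 2.
    by rewrite -(real_normK (num_real (y - x))) lerXn2r ?nnegrE// ltW.
  have : 2 * M <= K * (y - x) ^+ 2.
    rewrite /K mulrAC ler_pdivlMr ?exprn_gt0//.
    by apply: ler_wpM2l => //; rewrite mulr_ge0 ?ltW.
  by move=> ?; lra.
have [n nP] : exists n : nat, K / (e / 2) < n.+1%:R.
  by exists (Num.trunc (K / (e / 2))); exact: truncnS_gt.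
exists (bernstein h n.+1) => x x01; rewrite horner_bernstein.
have N0 : 0 < n.+1%:R :> R by rewrite ltr0n.
set N := n.+1 in nP N0 *.
set g := fun k : nat => _.
pose q (k : nat) := (k%:R - N%:R * x) ^+ 2.
have gP k : `|h x - g k| <= e / 2 + K / N%:R ^+ 2 * q k.
  apply: (le_trans (hK _ _ x01 _)); first by rewrite divr_ge0.
  rewrite lerD2l -mulrA ler_wpM2l// /q -exprVn -exprMn mulrBr.
  by rewrite mulKf ?gt_eqF// mulrC.
have qE : iter N (bernoulli_step x) q 0 = N%:R * (x - x ^+ 2).
  by rewrite bernoulli_step_variance; ring.
have small : K / N%:R ^+ 2 * (N%:R * (x - x ^+ 2)) <= e / 2.
  rewrite [leLHS](_ : _ = K / N%:R * (x - x ^+ 2)); last by field; rewrite gt_eqF.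
  rewrite ltr_pdivrMr in nP; last by lra.
  apply: (@le_trans _ _ (K / N%:R)); last by rewrite ler_pdivrMr// mulrC ltW.
  apply: ler_piMr; first exact: divr_ge0 K0 (ltW N0).
  by move/andP: x01 => [x0 x1]; nra.
rewrite -/g ler_distlC; apply/andP; split.
  have := @bernoulli_step_le x (fun k => (h x - e / 2) + (- (K / N%:R ^+ 2)) * q k)
    g x01 _ N 0%N.
  rewrite bernoulli_step_affine qE.
  move=> H; have {}H := H _; apply: le_trans (H _); first by lra.
  by move=> k; have := gP k; rewrite ler_distlC => /andP[]; lra.
have := @bernoulli_step_le x g (fun k => (h x + e / 2) + (K / N%:R ^+ 2) * q k)
  x01 _ N 0%N.
rewrite bernoulli_step_affine qE.
move=> H; apply: (le_trans (H _)); last by lra.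
by move=> k; have := gP k; rewrite ler_distlC => /andP[]; lra.
Qed.

End bernstein.

Lemma integrable_bounded (R : realType) (d : measure_display)
    (T : measurableType d) (mu : probability T R) (f : T -> R) (M : R) :
  measurable_fun setT f -> (forall x, `|f x| <= M) ->
  mu.-integrable setT (EFin \o f).
Proof.
move=> mf fM; apply: measurable_bounded_integrable => //.
  by rewrite /= probability_setT ltry.
exists M; split=> [|y My x _]; [exact: num_real|exact: le_trans (fM x) (ltW My)].
Qed.

(** * Polynomials in an exponential and convergence of Laplace transforms *)

Section laplace.
Context {R : realType}.

Lemma expRN_le1 (s x : R) : 0 <= s -> 0 <= x -> expR (- s * x) <= 1.
Proof. by move=> s0 x0; rewrite -expR0 ler_expR mulNr oppr_le0 mulr_ge0. Qed.

Lemma integrable_expRN (d : measure_display) (T : measurableType d)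
    (P : probability T R) (X : T -> R) (s : R) : measurable_fun setT X ->
  (forall w, 0 <= X w) -> 0 <= s ->
  P.-integrable setT (EFin \o (fun w => expR (- s * X w))).
Proof.
move=> mX X0 s0; apply: (@integrable_bounded _ _ _ _ _ 1) => [|w].
  by apply: measurableT_comp => //; exact: measurable_funM.
by rewrite ger0_norm ?expR_ge0// expRN_le1.
Qed.

(** The extra power [k] carries the induction on [p]: passing from [p] to [p * 'X + c%:P] raises [k]
    by one and leaves a pure exponential. *)
Lemma integrable_poly_expRN (d : measure_display) (T : measurableType d)
    (P : probability T R) (X : T -> R) (s : R) (p : {poly R}) (k : nat) :
  measurable_fun setT X -> (forall w, 0 <= X w) -> 0 <= s ->
  P.-integrable setT
    (EFin \o (fun w => p.[expR (- s * X w)] * expR (- s * X w) ^+ k)).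
Proof.
move=> mX X0 s0; elim/poly_ind: p k => [|p c IH] k.
  apply: (@integrable_bounded _ _ _ _ _ 0) => [|w].
    by under eq_fun do rewrite horner0 mul0r; exact: measurable_cst.
  by rewrite horner0 mul0r normr0.
have : P.-integrable setT
    ((EFin \o (fun w => (p.[expR (- s * X w)] * expR (- s * X w) ^+ k.+1)%R)) \+
     (fun w => c%:E * (expR (- (k%:R * s) * X w))%:E))%E.
  apply: integrableD => //; apply: integrableZl => //.
  by apply: integrable_expRN => //; rewrite mulr_ge0.
apply: eq_integrable => // w _ /=.
rewrite -EFinM -EFinD !hornerE; congr EFin.
by rewrite -mulrN -mulrA expRM_natl exprS; ring.
Qed.

(* In the variable [t = exp (- delta x)], the function [g x] multiplied by
   [exp (- delta x)] extends continuously to [[0, 1]]. *)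
Lemma exp_poly_approx (g : R -> R) (M del e : R) :
  continuous g -> (forall x, `|g x| <= M) -> 0 < del -> 0 < e ->
  exists p : {poly R}, forall x, 0 <= x ->
    `|g x - p.[expR (- del * x)]| <= M * (1 - expR (- del * x)) + e.
Proof.
move=> cg gM del0 e0.
pose h t := t * g (- ln t / del).
have ch : continuous h.
  move=> t; have [t0|t0|->] := ltgtP t 0.
  (* [ln] is 0 on nonpositive reals, so [h] is linear there. *)
  - have H : {near t, (fun t => t * g 0) =1 h}.
      near=> x; rewrite /h ln0 ?oppr0 ?mul0r//.
      by apply/ltW; near: x; exact: lt_nbhsl.
    rewrite /continuous_at -(nbhs_singleton H).
    apply: cvg_trans (near_eq_cvg H) _.
    by apply: cvgM => //; exact: cvg_cst.
  - apply: cvgM => //; apply: continuous_comp; last exact: cg.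
    apply: cvgM; last exact: cvg_cst.
    by apply: cvgN; exact: continuous_ln.
  - apply/cvgrPdist_lt => r r0; rewrite /h mul0r; near=> y.
    rewrite sub0r normrN normrM.
    apply: (@le_lt_trans _ _ (`|y| * (`|M| + 1))).
      rewrite ler_wpM2l// (le_trans (gM _))// (le_trans (ler_norm M))//.
      by rewrite lerDl.
    rewrite -ltr_pdivlMr ?ltr_wpDl//; near: y.
    by apply: (@nbhs0_lt R R); rewrite divr_gt0// ltr_wpDl.
have [p pP] := weierstrass ch e0.
exists p => x x0; set t := expR _.
have t0 : 0 < t := expR_gt0 _.
have t1 : t <= 1 by rewrite expRN_le1// ltW.
(* The polynomial approximates [t * g x] and not [g x]; the discrepancy is the term [M * (1 - t)] of
   the bound. *)
have -> : g x - p.[t] = (1 - t) * g x + (h t - p.[t]).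
  rewrite /h /t expRK (_ : _ / del = x); first by ring.
  by field; rewrite gt_eqF.
apply: (le_trans (ler_normD _ _)); apply: lerD; last first.
  by apply: pP; rewrite ltW.
by rewrite normrM ger0_norm ?subr_ge0// mulrC ler_wpM2r// subr_ge0.
Unshelve. all: by end_near. Qed.

(** After integration the approximation error involves only the Laplace transform at [del], whose
    limit is known. *)
Lemma dist_integral_exp_poly (d : measure_display) (T : measurableType d)
    (P : probability T R) (X : T -> R) (g : R -> R) (p : {poly R}) (M del e : R) :
  measurable_fun setT X -> (forall w, 0 <= X w) -> continuous g ->
  (forall x, `|g x| <= M) -> 0 < del ->
  (forall x, 0 <= x ->
    `|g x - p.[expR (- del * x)]| <= M * (1 - expR (- del * x)) + e) ->
  `|\int[P]_w g (X w) - \int[P]_w p.[expR (- del * X w)]| <=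
    M * (1 - \int[P]_w expR (- del * X w)) + e.
Proof.
move=> mX X0 cg gM del0 gp.
have ig : P.-integrable setT (EFin \o (fun w => g (X w))).
  apply: (@integrable_bounded _ _ _ _ _ M) => [|w]; last exact: gM.
  by apply: measurableT_comp => //; exact: continuous_measurable_fun.
have ip : P.-integrable setT (EFin \o (fun w => p.[expR (- del * X w)])).
  apply: eq_integrable (integrable_poly_expRN P p 0 mX X0 (ltW del0)) => //.
  by move=> w _ /=; rewrite expr0 mulr1.
have iE : P.-integrable setT (EFin \o (fun w => expR (- del * X w))).
  by apply: integrable_expRN => //; exact: ltW.
have ic (c : R) : P.-integrable setT (EFin \o (fun w : T => c)).
  by apply: (@integrable_bounded _ _ _ _ _ `|c|).
rewrite -RintegralB//.
apply: (le_trans (le_normr_Rintegral _ _)) => //.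
  exact: (integrableB _ ig ip).
have -> : M * (1 - \int[P]_w expR (- del * X w)) + e =
    \int[P]_w (M * (1 - expR (- del * X w)) + e).
  have i1 : P.-integrable setT (EFin \o (fun w => 1 - expR (- del * X w))).
    exact: (integrableB _ (ic 1) iE).
  rewrite RintegralD//; last by apply: (integrableZl _ M i1).
  rewrite RintegralZl// RintegralB// !Rintegral_cst//= !probability_setT/=.
  by rewrite !mulr1.
apply: le_Rintegral => //.
- exact: (integrable_norm (integrableB _ ig ip)).
- have i1 : P.-integrable setT (EFin \o (fun w => 1 - expR (- del * X w))).
    exact: (integrableB _ (ic 1) iE).
  exact: (integrableD _ (integrableZl _ M i1) (ic e)).
- by move=> w _; exact: gp.
Qed.

End laplace.

Unset Implicit Arguments.

Section laplace_cvg.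
Context {R : realType} {I : Type} (F : set_system I) {FF : ProperFilter F}.
Context {d : I -> measure_display} {Omega : forall i, measurableType (d i)}.
Context (P : forall i, probability (Omega i) R) (X : forall i, Omega i -> R).
Context {d' : measure_display} {Omega' : measurableType d'}.
Context (P' : probability Omega' R) (Y : Omega' -> R) (mean : R).
Hypothesis mX : forall i, measurable_fun setT (X i).
Hypothesis X0 : forall i w, 0 <= X i w.
Hypothesis mY : measurable_fun setT Y.
Hypothesis Y0 : forall w, 0 <= Y w.
Hypothesis LX : forall s, 0 < s ->
  \int[P i]_w expR (- s * X i w) @[i --> F] --> (1 + s * mean)^-1.
Hypothesis LY : forall s, 0 < s ->
  \int[P']_w expR (- s * Y w) = (1 + s * mean)^-1.
Hypothesis mean0 : 0 < mean.

Lemma cvg_exp_poly (s : R) (p : {poly R}) (k : nat) : 0 < s ->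
  \int[P i]_w (p.[expR (- s * X i w)] * expR (- s * X i w) ^+ k) @[i --> F] -->
  \int[P']_w (p.[expR (- s * Y w)] * expR (- s * Y w) ^+ k).
Proof.
move=> s0; have s0' := ltW s0; elim/poly_ind: p k => [|p c IH] k.
  have E0 dd (T : measurableType dd) (Q : probability T R) (Z : T -> R) :
      \int[Q]_w ((0 : {poly R}).[expR (- s * Z w)] * expR (- s * Z w) ^+ k) = 0.
    under eq_Rintegral do rewrite horner0 mul0r.
    by rewrite Rintegral_cst// mul0r.
  rewrite E0 (_ : (fun i => _) = cst 0); first exact: cvg_cst.
  by apply/funext => i; rewrite E0.
have E dd (T : measurableType dd) (Q : probability T R) (Z : T -> R) :
    measurable_fun setT Z -> (forall w, 0 <= Z w) ->
  \int[Q]_w ((p * 'X + c%:P).[expR (- s * Z w)] * expR (- s * Z w) ^+ k) =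
  \int[Q]_w (p.[expR (- s * Z w)] * expR (- s * Z w) ^+ k.+1) +
  c * \int[Q]_w expR (- (k%:R * s) * Z w).
  move=> mZ Z0.
  have ks0 : 0 <= k%:R * s by rewrite mulr_ge0.
  have iE := integrable_expRN Q mZ Z0 ks0.
  rewrite -RintegralZl// -RintegralD//.
  - apply: eq_Rintegral => w _; rewrite !hornerE.
    by rewrite -mulrN -mulrA expRM_natl exprS; ring.
  - exact: integrable_poly_expRN.
  - exact: (integrableZl _ c iE).
rewrite E// (_ : (fun i => \int[P i]_w _) = fun i =>
  \int[P i]_w (p.[expR (- s * X i w)] * expR (- s * X i w) ^+ k.+1) +
  c * \int[P i]_w expR (- (k%:R * s) * X i w)); last first.
  by apply/funext => i; rewrite E.
apply: cvgD => //; apply: cvgM; first exact: cvg_cst.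
(* [LX] and [LY] speak only of positive arguments; for [k = 0] the integrand is the constant 1. *)
case: k {E} => [|k].
  have E0 dd (T : measurableType dd) (Q : probability T R) (Z : T -> R) :
      \int[Q]_w expR (- (0%:R * s) * Z w) = 1.
    under eq_Rintegral do rewrite mul0r oppr0 mul0r expR0.
    by rewrite Rintegral_cst//= probability_setT mul1r.
  rewrite E0 (_ : (fun i => _) = cst 1); first exact: cvg_cst.
  by apply/funext => i; rewrite E0.
have k0 : 0 < k.+1%:R * s by rewrite mulr_gt0.
by rewrite LY//; exact: LX.
Qed.

Lemma cvg_Laplace (g : R -> R) : continuous g -> bounded_fun g ->
  \int[P i]_w g (X i w) @[i --> F] --> \int[P']_w g (Y w).
Proof.
move=> cg [M0 [_ gM0]].
have [M M1 gM] : exists2 M : R, 1 <= M & forall x, `|g x| <= M.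
  exists (`|M0| + 1) => [|x]; first by rewrite lerDr.
  by apply: (gM0 (`|M0| + 1)) => //; rewrite ltr_pwDr// ler_norm.
apply/cvgrPdist_le => e e0.
(* Chosen so that [M * (1 - (1 + del * mean)^-1) <= M * del * mean = e / 6]: the limit law
   contributes little to the error. *)
pose del := e / (6 * M * mean).
have del0 : 0 < del by rewrite /del divr_gt0// !mulr_gt0//; lra.
have Ldel : M * (1 - (1 + del * mean)^-1) <= e / 6.
  have D0 : 0 < del * mean by rewrite mulr_gt0.
  have -> : 1 - (1 + del * mean)^-1 = (del * mean) * (1 + del * mean)^-1.
    by field; rewrite gt_eqF// addr_gt0.
  have L1 : (1 + del * mean)^-1 <= 1 by rewrite invf_le1 ?addr_gt0//; lra.
  have -> : e / 6 = M * (del * mean) by rewrite /del; field; rewrite !gt_eqF//; lra.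
  rewrite ler_pM2l; last by lra.
  by rewrite ler_piMr// ltW.
have e12 : 0 < e / 12 by lra.
have [p pP] := exp_poly_approx cg gM del0 e12.
have /cvgrPdist_le /(_ (e / (12 * M))) HL := LX _ del0.
have /cvgrPdist_le /(_ (e / 12) e12) Hp := cvg_exp_poly _ p 0 del0.
near=> i.
have h1 := dist_integral_exp_poly (P i) (mX i) (X0 i) cg gM del0 pP.
have h2 := dist_integral_exp_poly P' mY Y0 cg gM del0 pP.
have L1 : `|(1 + del * mean)^-1 - \int[P i]_w expR (- del * X i w)| <= e / (12 * M).
  by near: i; apply: HL; rewrite divr_gt0//; lra.
have L2 : `|\int[P']_w p.[expR (- del * Y w)] -
    \int[P i]_w p.[expR (- del * X i w)]| <= e / 12.
  have E dd (T : measurableType dd) (Q : probability T R) (Z : T -> R) :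
      \int[Q]_w p.[expR (- del * Z w)] =
      \int[Q]_w (p.[expR (- del * Z w)] * expR (- del * Z w) ^+ 0).
    by apply: eq_Rintegral => w _; rewrite expr0 mulr1.
  by rewrite !E; near: i; exact: Hp.
rewrite LY// in h2.
have h3 : M * (1 - \int[P i]_w expR (- del * X i w)) <= e / 6 + e / 12.
  apply: (@le_trans _ _ (M * (1 - (1 + del * mean)^-1) + M * (e / (12 * M)))).
    rewrite -mulrDr ler_pM2l; last by lra.
    by move: L1; rewrite ler_distl => /andP[]; lra.
  apply: lerD => //.
  by rewrite le_eqVlt; apply/orP; left; apply/eqP; field; rewrite gt_eqF//; lra.
move: h1 h2 L2; rewrite !ler_distl => /andP[? ?] /andP[? ?] /andP[? ?].
by apply/andP; split; lra.
Unshelve. all: by end_near. Qed.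

End laplace_cvg.

Set Implicit Arguments.

(** * Exponential distributions *)

Section exponential.
Context {R : realType} (rate : R).
Hypothesis rate0 : 0 < rate.
Local Notation mu := (@lebesgue_measure R).

Lemma exponential_prob_dominates : exponential_prob rate `<< mu.
Proof.
apply/null_content_dominatesP => A mA muA0; rewrite /exponential_prob.
apply: null_set_integral => //; apply/measurable_funTS/measurable_EFinP.
exact: measurable_exponential_pdf.
Qed.

Lemma exponential_probability : exists nu : probability (measurableTypeR R) R,
  (nu : set (measurableTypeR R) -> \bar R) = exponential_prob rate.
Proof.
by exists (exponential_distribution_exponential_prob__canonical__probability_measure_Probability
  rate0).
Qed.

(** [exponential_prob] is given by integrating its density over sets; the density therefore agrees
    almost everywhere with the Radon-Nikodym derivative, for which the change of variables is
    available. *)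
Lemma integral_exponential_prob (f : R -> R) (M : R) :
  measurable_fun setT f -> (forall x, `|f x| <= M) ->
  (\int[exponential_prob rate]_x (f x)%:E =
   \int[mu]_x ((f x)%:E * (exponential_pdf rate x)%:E))%E.
Proof.
move=> mf fM.
have fi : (exponential_prob rate).-integrable setT (EFin \o f).
  have [nu <-] := exponential_probability.
  exact: (@integrable_bounded R _ (measurableTypeR R) nu f M).
rewrite -(Radon_Nikodym_change_of_variables exponential_prob_dominates)//=.
have mef : measurable_fun setT (EFin \o f) by apply/measurable_EFinP.
apply: ae_eq_integral => //.
- apply: emeasurable_funM => //; apply: (measurable_int mu).
  by apply: Radon_Nikodym_integrable; exact: exponential_prob_dominates.
- apply: emeasurable_funM => //.
  by apply/measurable_EFinP; exact: measurable_exponential_pdf.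
- apply: ae_eqe_mul2l => /=.
  rewrite Radon_NikodymE//=; first exact: exponential_prob_dominates.
  move=> abmu; case: cid => /= h [h1 h2 h3].
  apply: integral_ae_eq => //=.
    by apply/measurable_EFinP; exact: measurable_exponential_pdf.
  by move=> E _ mE; rewrite -h3.
Qed.

Lemma exponential_prob_itvoy (x : R) :
  exponential_prob rate `]x, +oo[ = (expR (- rate * Num.max 0 x))%:E.
Proof.
have [nu nuE] := exponential_probability; rewrite -nuE.
have nu0 : nu `]-oo, 0[%classic = 0%E.
  rewrite nuE; apply: integral0_eq => y /=; rewrite in_itv/= => y0.
  by rewrite lt0_exponential_pdf.
have nuC : nu `]x, +oo[%classic = (1 - nu `]-oo, x]%classic)%E.
  by rewrite -setCitvl probability_setC.
rewrite nuC; have [x0|x0] := ltP 0 x.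
  have -> : `]-oo, x]%classic = `[0, x]%classic `|` `]-oo, 0[%classic.
    apply/seteqP; split => y /=; rewrite !in_itv/=.
      by move=> ->; case: (ltP y 0) => _; [right|left].
    by case=> [/andP[]//|y0]; rewrite ltW// (lt_trans y0).
  rewrite measureU0// [X in (1 - X)%E](_ : _ = exponential_prob rate `[0, x]); last by rewrite -nuE.
  rewrite exponential_prob_itv0c//.
  by rewrite -!EFinB; congr EFin; ring.
rewrite mulr0 expR0 [X in (1 - X)%E](_ : _ = 0%E) ?sube0//.
rewrite nuE /exponential_prob -integral_itv_bndo_bndc; last first.
  by apply/measurable_funTS/measurable_EFinP; exact: measurable_exponential_pdf.
apply: integral0_eq => y /=; rewrite in_itv/= => yx.
by rewrite lt0_exponential_pdf// (lt_le_trans yx).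
Qed.

End exponential.

(** The exponential factor times the density of rate [mean^-1] is [(1 + s * mean)^-1] times the
    density of rate [s + mean^-1], which has mass 1. The absolute value keeps the integrand bounded,
    since [X] is nonnegative only almost surely. *)
Lemma Laplace_exponential (R : realType) (d : measure_display)
    (T : measurableType d) (P : probability T R) (X : T -> R) (mean s : R) :
  measurable_fun setT X ->
  0 < mean -> 0 < s -> exponential_with_mean P X mean ->
  \int[P]_w expR (- s * `|X w|) = (1 + s * mean)^-1.
Proof.
move=> mX mean0 s0 XE.
have rate0 : 0 < mean^-1 by rewrite invr_gt0.
have mf : measurable_fun setT (fun x : R => expR (- s * `|x|)).
  apply: measurableT_comp => //; exact: measurable_funM.
have fM (x : R) : `|expR (- s * `|x|)| <= 1.
  by rewrite ger0_norm ?expR_ge0// expRN_le1// ltW.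
rewrite /Rintegral.
have [nu nuE] := exponential_probability rate0.
have [q qE] : exists q : {measure set (measurableTypeR R) -> \bar R},
    (q : set (measurableTypeR R) -> \bar R) = pushforward P (X : T -> measurableTypeR R).
  by unshelve eexists; first by refine (pushforward P (X : T -> measurableTypeR R)).
have -> : (\int[P]_w (expR (- s * `|X w|))%:E =
    \int[q]_x (expR (- s * `|x|))%:E)%E.
  rewrite qE integral_pushforward//; first exact/measurable_EFinP.
  by apply: (@integrable_bounded _ _ _ P _ 1) => //; exact: measurableT_comp mf mX.
have -> : (\int[q]_x (expR (- s * `|x|))%:E =
    \int[nu]_x (expR (- s * `|x|))%:E)%E.
  apply: eq_measure_integral => A mA _.
  by rewrite qE; have := XE A mA; rewrite -nuE.
rewrite nuE; rewrite (integral_exponential_prob _ mf fM)//.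
have sr0 : 0 < s + mean^-1 by rewrite addr_gt0.
have E (x : R) : expR (- s * `|x|) * exponential_pdf mean^-1 x =
   (1 + s * mean)^-1 * exponential_pdf (s + mean^-1) x.
  have [x0|x0] := ltP x 0; first by rewrite !lt0_exponential_pdf// !mulr0.
  rewrite !exponential_pdfE// ger0_norm// mulrCA -expRD -mulrDl -opprD.
  by rewrite mulrA; congr (_ * _); field; rewrite !gt_eqF//= addr_gt0// mulr_gt0.
under eq_integral do rewrite -EFinM E EFinM.
rewrite integralZl//; last exact: integrable_exponential_pdf.
by rewrite integral_exponential_pdf// mule1.
Qed.

Lemma exponential_with_mean_ae_ge0 (R : realType) (d : measure_display)
    (T : measurableType d) (P : probability T R) (X : T -> R) (mean : R) :
  measurable_fun setT X ->
  0 < mean -> exponential_with_mean P X mean -> {ae P, forall w, 0 <= X w}.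
Proof.
move=> mX mean0 XE; exists (X @^-1` `]-oo, 0[%classic); split.
- by rewrite -[X in measurable X]setTI; apply: mX.
- rewrite XE// /exponential_prob; apply: integral0_eq => x /=.
  by rewrite in_itv/= => x0; rewrite lt0_exponential_pdf.
- by move=> w /= /negP; rewrite -ltNge in_itv.
Qed.

(** Both laws have the same tails on the half-lines []x, +oo[], an intersection-stable generating
    family that exhausts the line, so they coincide. *)
Lemma exponential_with_mean_scale (R : realType) (d : measure_display)
    (T : measurableType d) (P : probability T R) (X : T -> R) (mean c : R) :
  measurable_fun setT X ->
  0 < mean -> 0 < c -> exponential_with_mean P X mean ->
  exponential_with_mean P (fun w => c * X w) (c * mean).
Proof.
move=> mX mean0 c0 XE A mA.
have mcX : measurable_fun setT (fun w => c * X w) by exact: measurable_funM.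
have rate0 : 0 < mean^-1 by rewrite invr_gt0.
have crate0 : 0 < (c * mean)^-1 by rewrite invr_gt0 mulr_gt0.
have [nu nuE] := exponential_probability crate0; rewrite -nuE.
have [q qE] : exists q : {measure set (measurableTypeR R) -> \bar R},
    (q : set (measurableTypeR R) -> \bar R) = pushforward P ((fun w => c * X w) : T -> measurableTypeR R).
  by unshelve eexists; first by refine (pushforward P ((fun w => c * X w) : T -> measurableTypeR R)).
have mG : @measurable _ (measurableTypeR R) = <<s RGenOInfty.G (R:=R)>> := RGenOInfty.measurableE R.
pose g (n : nat) : set (measurableTypeR R) := `]- n%:R, +oo[%classic.
have := @measure_unique _ R (measurableTypeR R) (RGenOInfty.G (R:=R)) g mG _ _ _ q nu _ _ A mA.
rewrite [q A](_ : _ = P ((fun w => c * X w) @^-1` A)); last by rewrite qE.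
apply.
- move=> _ _ [x ->] [y ->]; exists (Num.max x y).
  by apply/seteqP; split => z /=; rewrite !in_itv/= !andbT gt_max; move/andP.
- by move=> n; exists (- n%:R).
- apply/seteqP; split => // x _; exists (Num.trunc `|x|).+1 => //=.
  rewrite /g/= in_itv/= andbT ltrNl; apply: le_lt_trans (truncnS_gt _).
  by rewrite -normrN ler_norm.
- move=> _ [x ->].
  rewrite [RHS](_ : _ = exponential_prob (c * mean)^-1 `]x, +oo[); last by rewrite -nuE.
  rewrite exponential_prob_itvoy// qE /pushforward.
  rewrite (_ : _ @^-1` _ = X @^-1` `]x / c, +oo[); last first.
    by apply/seteqP; split => w /=; rewrite !in_itv/= !andbT ltr_pdivrMr// mulrC.
  rewrite XE// exponential_prob_itvoy//; congr (expR _)%:E.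
  have -> : Num.max 0 (x / c) = Num.max 0 x / c.
    by rewrite maxr_pMl ?mul0r// invr_ge0 ltW.
  by field; rewrite !gt_eqF.
- move=> k; rewrite qE; apply: le_lt_trans (ltry 1).
  apply: probability_le1; rewrite -[X in measurable X]setTI.
  by apply: mcX => //; exact: measurable_itv.
Qed.

(** * Stationary laws of bounded jump chains *)

Section jump_chain.
Context {R : realType} {d : measure_display} {T : measurableType d} {J : finType}.
Variables (q : T -> J -> R) (tau : J -> T -> T).

Definition jump_generator (f : T -> R) (z : T) : R :=
  \sum_j q z j * (f (tau j z) - f z).

Variable Lam : R.
Hypothesis q_ge0 : forall z j, 0 <= q z j.
Hypothesis q_le : forall z j, q z j <= Lam.

Lemma sum_rates_le (z : T) (F : J -> R) (B : R) : 0 <= B ->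
  (forall j, F j <= B) ->
  \sum_j q z j * F j <= #|J|%:R * (Lam * B).
Proof.
move=> B0 FB; rewrite mulr_natl -sumr_const; apply: ler_sum => j _.
apply: (@le_trans _ _ (q z j * B)); first exact: ler_wpM2l.
exact: ler_wpM2r.
Qed.

Lemma norm_jump_generator_le (f : T -> R) (B : R) : (forall z, `|f z| <= B) ->
  forall z, `|jump_generator f z| <= #|J|%:R * (Lam * (2 * B)).
Proof.
move=> fB z; apply: (le_trans (ler_norm_sum _ _ _)).
apply: (@le_trans _ _ (\sum_j q z j * `|f (tau j z) - f z|)).
  by apply: ler_sum => j _; rewrite normrM ger0_norm.
have B0 : 0 <= B by apply: le_trans (fB z).
apply: sum_rates_le => [|j]; first by rewrite mulr_ge0.
by rewrite (le_trans (ler_normB _ _))// mulrDl mul1r lerD.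
Qed.

Definition jump_semigroup (t : R) (f : T -> R) (z : T) : R :=
  limn (series (fun n => t ^+ n / n`!%:R * iter n jump_generator f z)).

Hypothesis Lam0 : 0 <= Lam.

Lemma norm_iter_jump_generator_le (f : T -> R) (B : R) :
  (forall z, `|f z| <= B) -> forall n z,
  `|iter n jump_generator f z| <= (#|J|%:R * (Lam * 2)) ^+ n * B.
Proof.
move=> fB; elim=> [|n IH] z /=; first by rewrite expr0 mul1r.
apply: (le_trans (norm_jump_generator_le IH z)).
by rewrite exprS le_eqVlt; apply/orP; left; apply/eqP; ring.
Qed.

(** Second-order Taylor remainder of the exponential series. Each application of the generator costs
    a factor [c], and [t <= 1] lets [t ^+ 2] be pulled out of the tail, which leaves a bound uniform
    in [z]. *)
Lemma jump_semigroup_expand (f : T -> R) (B : R) : (forall z, `|f z| <= B) ->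
  exists2 K : R, 0 <= K & forall t, 0 <= t <= 1 -> forall z,
    `|jump_semigroup t f z - (f z + t * jump_generator f z)| <= t ^+ 2 * K.
Proof.
move=> fB.
pose c := #|J|%:R * (Lam * 2).
have c0 : 0 <= c by rewrite !mulr_ge0.
have B0 (z : T) : 0 <= B by apply: le_trans (fB z).
exists (`|B| * expR c); first by rewrite mulr_ge0// expR_ge0.
move=> t /andP[t0 t1] z; rewrite /jump_semigroup; set u := fun n => _.
have fact_inv0 n : 0 <= (n`!%:R)^-1 :> R by rewrite invr_ge0.
have uP n : `|u n| <= B * (c ^+ n / n`!%:R).
  rewrite /u normrM normrM normfV ger0_norm ?exprn_ge0//.
  rewrite [`|n`!%:R|]ger0_norm//.
  apply: (@le_trans _ _ (n`!%:R^-1 * (c ^+ n * B))).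
    apply: ler_pM => //; first by rewrite divr_ge0 ?exprn_ge0.
      by rewrite ler_piMl ?exprn_ile1.
    exact: norm_iter_jump_generator_le.
  by rewrite le_eqVlt; apply/orP; left; apply/eqP; ring.
have cvgu : cvgn (series u).
  apply: normed_cvg; apply: (@series_le_cvg _ _ (fun n => B * (c ^+ n / n`!%:R))).
  - by move=> n; exact: normr_ge0.
  - by move=> n; rewrite mulr_ge0 ?(B0 z)// divr_ge0 ?exprn_ge0.
  - by move=> n; exact: uP.
  - have -> : (fun n => B * (c ^+ n / n`!%:R)) = B *: exp_coeff c.
      by apply/funext => n; rewrite /exp_coeff.
    by apply: is_cvg_seriesZ; exact: is_cvg_series_exp_coeff.
have bound n : `|series u n.+2 - (f z + t * jump_generator f z)| <=
    t ^+ 2 * (`|B| * expR c).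
  rewrite /series /= big_nat_recl// big_nat_recl//=.
  have -> : u 0%N = f z by rewrite /u expr0 fact0 divr1 mul1r.
  have -> : u 1%N = t * jump_generator f z by rewrite /u expr1 divr1.
  rewrite addrA [X in X - _]addrC addrK.
  apply: (le_trans (ler_norm_sum _ _ _)).
  apply: (@le_trans _ _ (\sum_(0 <= i < n) t ^+ 2 * (`|B| * (c ^+ i.+2 / i.+2`!%:R)))).
    apply: ler_sum => i _.
    rewrite /u normrM normrM normfV ger0_norm ?exprn_ge0//.
    rewrite [`|i.+2`!%:R|]ger0_norm//.
    apply: (@le_trans _ _ ((t ^+ 2 / i.+2`!%:R) * (c ^+ i.+2 * B))).
      apply: ler_pM => //; first by rewrite divr_ge0 ?exprn_ge0.
        rewrite ler_wpM2r// -[i.+2]addn2 exprD ler_piMl ?exprn_ge0//.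
        exact: exprn_ile1.
      exact: norm_iter_jump_generator_le.
    rewrite (ger0_norm (B0 z)).
    by rewrite le_eqVlt; apply/orP; left; apply/eqP; ring.
  rewrite -mulr_sumr ler_wpM2l ?exprn_ge0// -mulr_sumr ler_wpM2l//.
  have : series (exp_coeff c) n.+2 <= expR c.
    apply: nondecreasing_cvgn_le; last exact: is_cvg_series_exp_coeff.
    apply: nondecreasing_series => i _ _; rewrite /exp_coeff divr_ge0 ?exprn_ge0//.
  rewrite /series /= big_nat_recl// big_nat_recl//=; apply: le_trans.
  rewrite addrA lerDr addr_ge0// /exp_coeff divr_ge0 ?exprn_ge0//.
have cvgu2 : (series u n.+2 @[n --> \oo] --> limn (series u)).
  by rewrite (cvg_shiftS (fun n => series u n.+1)) (cvg_shiftS (series u)).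
have : `|series u n.+2 - (f z + t * jump_generator f z)| @[n --> \oo] -->
   `|limn (series u) - (f z + t * jump_generator f z)|.
  by apply: cvg_norm; apply: cvgB => //; exact: cvg_cst.
move=> H; rewrite -(cvg_lim _ H)//; apply: limr_le; first by apply/cvg_ex; eexists; exact: H.
by apply: nearW.
Qed.

Variable pi : probability T R.
Hypothesis mT : forall f : T -> R, measurable_fun setT f.

(** Stationarity makes [t] times the mean of the generator equal to minus the mean of a remainder of
    size [t ^+ 2 * K]; dividing by [t] and taking [t] small gives 0. *)
Lemma stationary_jump_generator (f : T -> R) (B : R) :
  (forall (t : R) (g : T -> R), 0 <= t -> bounded_fun g ->
    ('E_pi[jump_semigroup t g] = 'E_pi[g])%E) ->
  (forall z, `|f z| <= B) -> \int[pi]_z jump_generator f z = 0.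
Proof.
move=> stat fB.
have [K K0 KP] := jump_semigroup_expand fB.
have GB := norm_jump_generator_le fB.
have iF := integrable_bounded pi (mT _) fB.
have iG := integrable_bounded pi (mT _) GB.
apply/eqP; rewrite -normr_eq0 eq_le normr_ge0 andbT.
apply/ler_addgt0Pr => e e0; rewrite add0r.
pose t := Num.min 1 (e / (K + 1)).
have K1 : 0 < K + 1 by rewrite ltr_wpDl.
have t0 : 0 < t by rewrite lt_min ltr01 divr_gt0.
have t1 : t <= 1 by rewrite ge_min lexx.
have tK : t * K <= e.
  apply: (@le_trans _ _ (e / (K + 1) * K)).
    by rewrite ler_wpM2r// ge_min lexx orbT.
  rewrite mulrAC ler_pdivrMr//; nra.
pose D z := jump_semigroup t f z - (f z + t * jump_generator f z).
have DB z : `|D z| <= t ^+ 2 * K by apply: KP; rewrite ltW.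
have iD := integrable_bounded pi (mT _) DB.
have itG : pi.-integrable setT (EFin \o (fun z => t * jump_generator f z)).
  exact: (integrableZl _ t iG).
have bf : bounded_fun f.
  by exists B; split=> [|y By x _]; [exact: num_real|exact: le_trans (fB x) (ltW By)].
have : \int[pi]_z jump_semigroup t f z = \int[pi]_z f z.
  by have := stat t f (ltW t0) bf; rewrite unlock /Rintegral => ->.
have -> : \int[pi]_z jump_semigroup t f z =
    \int[pi]_z f z + t * \int[pi]_z jump_generator f z + \int[pi]_z D z.
  rewrite -RintegralZl// -!RintegralD//; last exact: (integrableD _ iF itG).
  by apply: eq_Rintegral => z _; rewrite /D; ring.
move=> H; have {}H : t * \int[pi]_z jump_generator f z = - \int[pi]_z D z by lra.
have : t * `|\int[pi]_z jump_generator f z| <= t ^+ 2 * K.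
  rewrite -[X in X * _](gtr0_norm t0) -normrM H normrN.
  apply: (le_trans (le_normr_Rintegral _ _)) => //.
  have -> : t ^+ 2 * K = \int[pi]_z (t ^+ 2 * K).
    by rewrite Rintegral_cst//= probability_setT mulr1.
  apply: le_Rintegral => //; first exact: integrable_norm.
  by apply: (@integrable_bounded _ _ _ _ _ `|t ^+ 2 * K|).
rewrite expr2 -mulrA ler_pM2l// => /le_trans; exact.
Qed.

Hypothesis pi_generator : forall (f : T -> R) B, (forall z, `|f z| <= B) ->
  \int[pi]_z jump_generator f z = 0.

(* The bounded test function [exp (- eps V)] is convex in [V], so that
   [G exp (- eps V) >= - eps exp (- eps V) G V]. *)
Lemma foster_bound (V phi : T -> R) (C : R) :
  0 <= C -> (forall z, 0 <= V z) -> (forall z, 0 <= phi z) ->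
  (forall z, jump_generator V z <= - phi z + C) ->
  pi.-integrable setT (EFin \o phi) /\ \int[pi]_z phi z <= C.
Proof.
move=> C0 V0 phi0 GV.
have mE (g : T -> R) : measurable_fun setT (EFin \o g) by apply/measurable_EFinP.
have trunc_le (eps : R) : 0 < eps ->
    (\int[pi]_z (expR (- eps * V z) * phi z)%:E <= C%:E)%E.
  move=> eps0; pose f z := expR (- eps * V z).
  have f0 z : 0 <= f z := expR_ge0 _.
  have f1 z : `|f z| <= 1 by rewrite ger0_norm// expRN_le1// ltW.
  have GB := norm_jump_generator_le f1.
  have Gf z : eps * (f z * phi z - C) <= jump_generator f z.
    apply: (@le_trans _ _ (\sum_j q z j * (- eps * f z * (V (tau j z) - V z)))).
      rewrite (_ : \sum_j _ = - (eps * f z) * jump_generator V z); last first.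
        by rewrite /jump_generator mulr_sumr; apply: eq_bigr => j _; ring.
      have fz1 : f z <= 1 by rewrite expRN_le1// ltW.
      have H1 := ler_wpM2l (mulr_ge0 (ltW eps0) (f0 z)) (GV z).
      have H2 : f z * C <= C by rewrite ler_piMl.
      have H3 := ler_wpM2l (ltW eps0) H2.
      by nra.
    apply: ler_sum => j _; apply: ler_wpM2l => //.
    have -> : f (tau j z) = f z * expR (- eps * (V (tau j z) - V z)).
      by rewrite /f -expRD; congr expR; ring.
    have := expR_ge1Dx (- eps * (V (tau j z) - V z)); move: (f0 z).
    set e := expR (- eps * _); set x := V _ - _; move=> h1 h2.
    have := ler_wpM2l h1 h2; lra.
  set K := _ * _ in GB.
  (* [phi] may be unbounded and is not yet known to be integrable; the damped product is bounded
     because the generator of the bounded [f] is. *)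
  have fphiB z : `|f z * phi z| <= K / eps + C.
    rewrite ger0_norm ?mulr_ge0// -lerBlDr ler_pdivlMr// mulrC.
    exact: le_trans (Gf z) (le_trans (ler_norm _) (GB z)).
  have iG := integrable_bounded pi (mT _) GB.
  have ifphi := integrable_bounded pi (mT _) fphiB.
  have iC (c : R) : pi.-integrable setT (EFin \o (fun _ : T => c)).
    by apply: (@integrable_bounded _ _ _ _ _ `|c|).
  have idiff : pi.-integrable setT (EFin \o (fun z => f z * phi z - C)).
    exact: (integrableB _ ifphi (iC C)).
  have : \int[pi]_z (eps * (f z * phi z - C)) <= 0.
    rewrite -(pi_generator f1); apply: le_Rintegral => //.
    exact: (integrableZl _ eps idiff).
  rewrite RintegralZl// pmulr_rle0// RintegralB// Rintegral_cst//=.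
  rewrite probability_setT mulr1 subr_le0 => H.
  rewrite -[leLHS]fineK ?lee_fin//; exact: integrable_fin_num.
have le_C : (\int[pi]_z (phi z)%:E <= C%:E)%E.
  (* With [eps = 1 / (n + 1)] the damping factor increases to 1, so monotone convergence removes
     it. *)
  pose g (n : nat) z := (expR (- n.+1%:R^-1 * V z) * phi z)%:E.
  have gcvg z : (g n z @[n --> \oo] --> (phi z)%:E)%E.
    apply/fine_cvgP; split; first exact: nearW.
    rewrite -[X in _ --> X]mul1r; apply: cvgM; last exact: cvg_cst.
    have H : - harmonic n * V z @[n --> \oo] --> 0 * V z.
      apply: cvgM; last exact: cvg_cst.
      by rewrite -[X in _ --> X]oppr0; apply: cvgN; exact: cvg_harmonic.
    by rewrite mul0r in H; rewrite -[X in _ --> X]expR0; apply: continuous_cvg H; exact: continuous_expR.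
  have gnd z m n : (m <= n)%N -> (g m z <= g n z)%E.
    move=> mn; rewrite lee_fin ler_wpM2r// ler_expR !mulNr lerN2.
    by rewrite ler_wpM2r// lef_pV2 ?posrE// ler_nat.
  have -> : (\int[pi]_z (phi z)%:E = \int[pi]_z limn (fun n => g n z))%E.
    by apply: eq_integral => z _; apply/esym/cvg_lim => //; exact: gcvg.
  rewrite monotone_convergence//; last 3 first.
  - by move=> n; exact: mE.
  - by move=> n z _; rewrite lee_fin mulr_ge0 ?expR_ge0.
  - by move=> z _ m n; exact: gnd.
  apply: lime_le.
    apply: ereal_nondecreasing_is_cvgn => m n mn.
    apply: ge0_le_integral => //; try exact: mE.
    - by move=> z _; rewrite lee_fin mulr_ge0 ?expR_ge0.
    - by move=> z _; exact: gnd.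
  by apply: nearW => n; apply: trunc_le; rewrite invr_gt0.
have iphi : pi.-integrable setT (EFin \o phi).
  apply/integrableP; split; first exact: mE.
  apply: le_lt_trans (ltry C).
  by under eq_integral do rewrite /= ger0_norm//.
split=> //; rewrite -lee_fin; apply: le_trans le_C.
by rewrite /Rintegral fineK// integrable_fin_num.
Qed.

End jump_chain.

(** * The static allocation problem and its dual *)

Section static_allocation.
Context {R : realType} {nI nK : nat} (S : parallel_server_system R nI nK).
Implicit Types (x : activity S -> R) (a b : activity S).

Lemma sum_by_class (F : activity S -> R) :
  \sum_a F a = \sum_i \sum_(a | job_class a == i) F a.
Proof. by rewrite (partition_big (@job_class _ _ _ S) predT). Qed.

Lemma sum_by_server (F : activity S -> R) :
  \sum_a F a = \sum_k \sum_(a | server a == k) F a.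
Proof. by rewrite (partition_big (@server _ _ _ S) predT). Qed.

Lemma service_rateK a : service_rate a * mean_service a = 1.
Proof. by rewrite mulfV// gt_eqF// service_rate_gt0. Qed.

Lemma mean_service_gt0 a : 0 < mean_service a.
Proof. by rewrite invr_gt0 service_rate_gt0. Qed.

(** The LP constraints without the capacity bounds: server loads stay free, so that their excess
    over a level can be minimized. *)
Definition flow x : Prop := (forall a, 0 <= x a) /\
  forall i, \sum_(a | job_class a == i) service_rate a * x a = arrival_rate S i.

Definition load x k : R := \sum_(a | server a == k) x a.

Lemma flow_class x : flow x -> forall i, exists a, job_class a = i.
Proof.
move=> [_ xi] i; apply/not_existsP => H.
have := arrival_rate_gt0 S i; rewrite -xi big1 ?ltxx// => a /eqP ai.
by case: (H a).
Qed.

Lemma flow_le x a : flow x -> x a <= arrival_rate S (job_class a) * mean_service a.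
Proof.
move=> [x0 xi]; rewrite -xi (bigD1 a)//= mulrDl mulrAC service_rateK mul1r lerDl.
rewrite mulr_ge0// ?(ltW (mean_service_gt0 _))// sumr_ge0// => b _.
by rewrite mulr_ge0// ltW// service_rate_gt0.
Qed.

Lemma flow_convex x y (h : R) : flow x -> flow y -> 0 <= h <= 1 ->
  flow (fun a => x a + h * (y a - x a)).
Proof.
move=> [x0 xi] [y0 yi] /andP[h0 h1]; split=> [a|i].
  have := x0 a; have := y0 a; nra.
rewrite -[RHS]addr0 -[in RHS](mulr0 h) -[in RHS](subrr (arrival_rate S i)).
rewrite -{1}(xi i) -{1}(yi i) -(xi i) -sumrB mulr_sumr -big_split/=.
by apply: eq_bigr => a _; ring.
Qed.

Lemma load_ge0_le x k : flow x ->
  0 <= load x k <= \sum_(a : activity S) arrival_rate S (job_class a) * mean_service a.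
Proof.
move=> fx; have [x0 xi] := fx; apply/andP; split; first exact: sumr_ge0.
rewrite /load big_mkcond/=; apply: ler_sum => a _.
case: ifP => _; first exact: flow_le.
by rewrite mulr_ge0// ltW// ?arrival_rate_gt0// mean_service_gt0.
Qed.

(** For fixed [u] the best [v i] is the least [mean_service a * u (server a)] over the activities of
    class [i]. Its dual value equals the [u]-weighted load of the flow that sends each class
    entirely through a cheapest activity. *)
Lemma dual_of_weights x (u : 'I_nK -> R) (t : R) :
  flow x -> (forall k, 0 <= u k) -> \sum_k u k <= 1 ->
  (forall y, flow y -> t <= \sum_k u k * load y k) ->
  exists v, dual_feasible S v u /\ t <= \sum_i arrival_rate S i * v i.
Proof.
move=> fx u0 u1 tu.
pose c a := mean_service a * u (server a).
have /choice[b bP] (i : 'I_nI) : exists b, job_class b = i /\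
    forall a, job_class a = i -> c b <= c a.
  have [a0 a0i] := flow_class fx i.
  have a0i' : job_class a0 == i by apply/eqP.
  case: (@arg_minP _ _ _ a0 (fun a => job_class a == i) c a0i') => b /eqP bi H.
  by exists b; split=> // a /eqP; exact: H.
exists (fun i => c (b i)); split.
  split=> // a; have [_ /(_ a erefl) H] := bP (job_class a).
  apply: le_trans (ler_wpM2l (ltW (service_rate_gt0 a)) H) _.
  by rewrite /c mulrA service_rateK mul1r.
pose y a := (a == b (job_class a))%:R *
  (arrival_rate S (job_class a) * mean_service a).
have E (F : activity S -> R) i :
    \sum_(a | job_class a == i) F a * y a =
    F (b i) * (arrival_rate S i * mean_service (b i)).
  have [bi _] := bP i.
  rewrite (bigD1 (b i)) ?bi//= /y bi eqxx mul1r big1 ?addr0// => a /andP[/eqP -> /negPf ->].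
  by rewrite mul0r mulr0.
have fy : flow y.
  split=> [a|i].
    by rewrite !mulr_ge0// ltW// ?arrival_rate_gt0// mean_service_gt0.
  by rewrite E mulrCA service_rateK mulr1.
apply: (le_trans (tu y fy)).
have -> : \sum_k u k * load y k = \sum_a u (server a) * y a.
  rewrite sum_by_server; apply: eq_bigr => k _; rewrite mulr_sumr.
  by apply: eq_bigr => a /eqP ->.
rewrite sum_by_class le_eqVlt; apply/orP; left; apply/eqP.
by apply: eq_bigr => i _; rewrite E /c; ring.
Qed.

Lemma sqr_max0D_le (p q : R) : (Num.max 0 (p + q)) ^+ 2 <= (Num.max 0 p + q) ^+ 2.
Proof.
by case: (leP 0 p) => hp; case: (leP 0 (p + q)) => hq; rewrite ?expr0n/=; nra.
Qed.

(* At a near-minimizer [x] of the convex function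
   [sum_k (max 0 (load x k - t)) ^ 2], the gradient is, up to normalization and
   a small error, a feasible dual weight vector with value at least [t]. *)
Lemma near_dual_optimal x (t h : R) : flow x -> 0 <= t < 1 -> 0 < h <= 1 ->
  (forall (y : activity S -> R) rho, lp_feasible y rho -> 1 <= rho) ->
  exists u, [/\ forall k, 0 <= u k, \sum_k u k <= 1 &
    forall y, flow y -> t - h * (1 + nK%:R *
      (\sum_(a : activity S) arrival_rate S (job_class a) * mean_service a) ^+ 2) / (1 - t)
      <= \sum_k u k * load y k].
Proof.
move=> fx /andP[t0 t1] /andP[h0 h1] opt.
set L := \sum_a _.
pose Phi (y : activity S -> R) := \sum_k (Num.max 0 (load y k - t)) ^+ 2.
have Phi0 y : 0 <= Phi y by apply: sumr_ge0 => k _; exact: sqr_ge0.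
(* Approximate minimality suffices: over a move of relative length [h], a defect [h ^+ 2] costs only
   order [h] in the directional derivative. *)
have [x1 [fx1 near]] : exists x1, flow x1 /\
    forall y, flow y -> Phi x1 <= Phi y + h ^+ 2.
  have ne : has_inf [set Phi y | y in flow].
    by split; [exists (Phi x), x|exists 0 => _ [y _ <-]].
  have h20 : 0 < h ^+ 2 by rewrite exprn_gt0.
  have [_ [x1 fx1 <-] Hlt] := inf_adherent h20 ne.
  exists x1; split=> // y fy; apply: (le_trans (ltW Hlt)); rewrite lerD2r.
  by apply: ge_inf; [exact: ne.2|exists y].
pose D k := Num.max 0 (load x1 k - t).
have D0 k : 0 <= D k by rewrite le_max lexx.
pose s := \sum_k D k.
(* A smaller total overload would bring every load below [t + (1 - t) / 2 = (1 + t) / 2 < 1],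
   contradicting the LP value 1. *)
have s_ge : (1 - t) / 2 <= s.
  rewrite leNgt; apply/negP => slt.
  have : 1 <= (1 + t) / 2; last by lra.
  apply: (opt x1); split; [exact: fx1.1|by lra|exact: fx1.2|move=> k].
  have : D k <= s by rewrite /s (bigD1 k)//= lerDl sumr_ge0.
  have : load x1 k - t <= D k by rewrite le_max lexx orbT.
  rewrite /load; lra.
have s0 : 0 < s by apply: lt_le_trans s_ge; lra.
exists (fun k => D k / s); split.
- by move=> k; rewrite divr_ge0// ltW.
- by rewrite -mulr_suml divff// gt_eqF.
move=> y fy.
have key : - (h * (1 + nK%:R * L ^+ 2)) / 2 <= \sum_k D k * (load y k - load x1 k).
  have h01 : 0 <= h <= 1 by rewrite ltW.
  have := near _ (flow_convex fx1 fy h01).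
  have loadE k : load (fun a => x1 a + h * (y a - x1 a)) k - t =
      (load x1 k - t) + h * (load y k - load x1 k).
    by rewrite /load big_split/= -mulr_sumr sumrB; ring.
  have PhiE : Phi (fun a => x1 a + h * (y a - x1 a)) <=
      Phi x1 + 2 * h * (\sum_k D k * (load y k - load x1 k)) +
      h ^+ 2 * (nK%:R * L ^+ 2).
    have -> : nK%:R * L ^+ 2 = \sum_(k < nK) L ^+ 2.
      by rewrite sumr_const card_ord mulr_natl.
    rewrite !mulr_sumr -!big_split/=; apply: ler_sum => k _.
    rewrite loadE; apply: (le_trans (sqr_max0D_le _ _)); rewrite -/(D k).
    have /andP[l0 l1] := load_ge0_le k fx1.
    have /andP[l2 l3] := load_ge0_le k fy.
    have : (load y k - load x1 k) ^+ 2 <= L ^+ 2 by rewrite -/L in l1 l3; nra.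
    have : 0 <= h ^+ 2 by exact: sqr_ge0.
    set dd := load y k - load x1 k; move=> ? ?; nra.
  move=> nearh.
  set Q := \sum_k D k * _ in PhiE *.
  have : 0 <= h * (2 * Q + h * (1 + nK%:R * L ^+ 2)) by lra.
  rewrite pmulr_rge0//; lra.
have lower : t * s <= \sum_k D k * load x1 k.
  rewrite mulr_sumr; apply: ler_sum => k _; rewrite mulrC.
  by rewrite /D; case: (leP 0 (load x1 k - t)) => H; [nra|rewrite !mul0r].
have -> : \sum_k D k / s * load y k = (\sum_k D k * load y k) / s.
  by rewrite mulr_suml; apply: eq_bigr => k _; rewrite mulrAC.
have split : \sum_k D k * (load y k - load x1 k) =
    \sum_k D k * load y k - \sum_k D k * load x1 k.
  by rewrite -sumrB; apply: eq_bigr => k _; rewrite mulrBr.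
rewrite split in key.
set A := h * (1 + nK%:R * L ^+ 2) in key *.
have A0 : 0 <= A by rewrite mulr_ge0 ?(ltW h0)// addr_ge0// mulr_ge0// sqr_ge0.
rewrite ler_pdivlMr// mulrBl.
have : A / 2 <= A / (1 - t) * s.
  rewrite -mulrA; apply: ler_wpM2l => //.
  rewrite mulrC ler_pdivlMr; last by lra.
  by rewrite mulrC.
by lra.
Qed.

(** The hard half of strong duality: dual feasible points of value arbitrarily close to 1 exist, and
    the optimal one dominates them all. *)
Lemma dual_value_ge1 (v : 'I_nI -> R) (u : 'I_nK -> R) :
  relaxed_heavy_traffic S -> dual_optimal S v u ->
  1 <= \sum_i arrival_rate S i * v i.
Proof.
move=> [x [[[x0 _ xi _] opt] _]] [_ dopt].
have fx : flow x by [].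
apply/ler_addgt0Pr => e e0.
set C := 1 + nK%:R * (\sum_(a : activity S) arrival_rate S (job_class a) * mean_service a) ^+ 2.
have C1 : 1 <= C by rewrite lerDl mulr_ge0// sqr_ge0.
pose d := Num.min 1 (e / 2).
have d0 : 0 < d by rewrite lt_min ltr01 divr_gt0.
have d1 : d <= 1 by rewrite ge_min lexx.
have de : d <= e / 2 by rewrite ge_min lexx orbT.
(* At level [t = 1 - d] the error [h * C / (1 - t)] equals [d], so the total loss is
   [2 * d <= e]. *)
pose h := d ^+ 2 / C.
have h0 : 0 < h by rewrite divr_gt0 ?exprn_gt0//; lra.
have h1 : h <= 1 by rewrite ler_pdivrMr; [nra|lra].
have t01 : 0 <= 1 - d < 1 by apply/andP; split; lra.
have h01 : 0 < h <= 1 by rewrite h0.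
have [u' [u'0 u'1 u'P]] := near_dual_optimal fx t01 h01 opt.
have [v' [dv' v'ge]] := dual_of_weights fx u'0 u'1 u'P.
have := le_trans v'ge (dopt _ _ dv').
rewrite -/C subKr (_ : h * C / d = d); first lra.
by rewrite /h; field; rewrite !gt_eqF//; lra.
Qed.

(** * Complementary slackness and positivity of the dual solution *)

Section dual.
Variables (v : 'I_nI -> R) (u : 'I_nK -> R).
Hypothesis rht : relaxed_heavy_traffic S.
Hypothesis dual : dual_optimal S v u.

(** The chain from 1 to the dual value, to the sum of [u], and back to 1 consists of equalities. The
    middle inequality is a sum over activities weighted by [x], so it is tight at each activity with
    [x a > 0]. *)
Lemma dual_slackness x : heavy_traffic_solution x ->
  [/\ \sum_i arrival_rate S i * v i = 1, \sum_k u k = 1 &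
   forall a, 0 < x a -> service_rate a * v (job_class a) = u (server a)].
Proof.
move=> [[[x0 _ xi _] _] x1]; have [[u0 vu u1] _] := dual.
have ge1 := dual_value_ge1 rht dual.
have E1 : \sum_i arrival_rate S i * v i =
    \sum_a x a * (service_rate a * v (job_class a)).
  rewrite sum_by_class; apply: eq_bigr => i _; rewrite -xi mulr_suml.
  by apply: eq_bigr => a /eqP ->; ring.
have E2 : \sum_k u k = \sum_a x a * u (server a).
  rewrite sum_by_server; apply: eq_bigr => k _; rewrite -[LHS]mul1r -(x1 k) mulr_suml.
  by apply: eq_bigr => a /eqP ->.
have le a : x a * (service_rate a * v (job_class a)) <= x a * u (server a).
  exact: ler_wpM2l.
have LE : \sum_i arrival_rate S i * v i <= \sum_k u k.
  by rewrite E1 E2; apply: ler_sum => a _.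
split; [lra|lra|move=> a xa].
apply/eqP; rewrite eq_le vu/= leNgt; apply/negP => lta.
have : \sum_i arrival_rate S i * v i < \sum_k u k; last by lra.
rewrite E1 E2 (bigD1 a)//= [ltRHS](bigD1 a)//=; apply: ltr_leD.
  by rewrite ltr_pM2l.
by apply: ler_sum => b _.
Qed.

(** Communication links may use different optimal solutions. Averaging one witness per activity
    gives a single solution for which all these activities are basic. *)
Lemma heavy_traffic_interior : exists2 x, heavy_traffic_solution x &
  forall y a, heavy_traffic_solution y -> 0 < y a -> 0 < x a.
Proof.
have [x0 hx0] := rht.
have /choice[Y YP] (a : activity S) : exists Ya, heavy_traffic_solution Ya /\
    forall y, heavy_traffic_solution y -> 0 < y a -> 0 < Ya a.
  have [[y [hy ya]]|H] := pselect (exists y, heavy_traffic_solution y /\ 0 < y a).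
    by exists y.
  by exists x0; split=> // y hy ya; exfalso; apply: H; exists y.
pose N := #|{: activity S}|%:R : R.
have [a0 _|H] := pickP (predT : pred (activity S)); last first.
  by exists x0 => // y a; have := H a.
have N0 : 0 < N by rewrite ltr0n; apply/card_gt0P; exists a0.
have avg (F : activity S -> R) (c : R) : (forall a, F a = c) ->
    N^-1 * \sum_a F a = c.
  move=> Fc; rewrite (eq_bigr (fun=> c))// sumr_const -mulr_natr mulrCA mulVf ?mulr1//.
  by rewrite gt_eqF.
have Y0 a b : 0 <= Y a b by have [[[[]]]] := YP a.
exists (fun b => N^-1 * \sum_a Y a b); last first.
  move=> y a hy ya; rewrite mulr_gt0 ?invr_gt0// (bigD1 a)//=.
  by rewrite ltr_pwDl ?sumr_ge0//; apply: (YP a).2 ya.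
have L1 k : \sum_(b | server b == k) N^-1 * \sum_a Y a b = 1.
  rewrite -mulr_sumr exchange_big/=; apply: avg => a.
  by have [[_]] := YP a.
split=> //; split; last by case: hx0 => -[].
split=> //.
- by move=> b; rewrite mulr_ge0 ?invr_ge0 ?(ltW N0)// sumr_ge0.
- move=> i; under eq_bigr do rewrite mulrCA mulr_sumr.
  rewrite -mulr_sumr exchange_big/=; apply: avg => a.
  by have [[[[]]]] := YP a.
- by move=> k; rewrite L1.
Qed.

Hypothesis rcrp : relaxed_complete_resource_pooling S.

Lemma communicate_ind (Q : 'I_nK -> 'I_nK -> Prop) :
  (forall k, Q k k) -> (forall k l m, Q k l -> Q l m -> Q k m) ->
  (forall a b, (exists2 x, heavy_traffic_solution x & 0 < x a /\ 0 < x b) ->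
    job_class a = job_class b -> Q (server a) (server b)) ->
  forall k l, Q k l.
Proof.
move=> Qr Qt Qd k l; have := rcrp.2 k l; elim => {k l}.
- move=> k l [x [hx [a [b [ab <- <- xa xb]]]]].
  by apply: Qd => //; exists x.
- exact: Qr.
- move=> k l m _ + _; exact: Qt.
Qed.

(** Some [u k] is positive because they sum to 1. Slackness makes both ends of a link positive
    multiples of the same [v i], so positivity spreads to all servers and then to the classes. *)
Lemma dual_gt0 : (forall k, 0 < u k) /\ (forall i, 0 < v i).
Proof.
have [x hx] := rht; have [l1 u1 _] := dual_slackness hx.
have [[u0 _ _] _] := dual.
have [k0 k0P] : exists k, 0 < u k.
  apply/not_existsP => H; have : \sum_k u k <= 0; last by lra.
  by apply: sumr_le0 => k _; rewrite leNgt; apply/negP => /H.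
have upos : forall k l, 0 < u k -> 0 < u l.
  apply: communicate_ind => [//|k l m H1 H2 /H1/H2//|a b [y hy [ya yb]] ab].
  have [_ _ sl] := dual_slackness hy.
  rewrite -(sl a ya) -(sl b yb) ab !pmulr_rgt0 ?service_rate_gt0//.
have uk k : 0 < u k := upos _ k k0P.
split=> // i.
have [[[x0 _ xi _] _] _] := hx.
have [a /eqP ai xa] : exists2 a, job_class a == i & 0 < x a.
  apply/not_exists2P => H; have := arrival_rate_gt0 S i.
  rewrite -xi big1 ?ltxx// => a ai; have [//|/negP] := H a.
  by rewrite -leNgt => xa; rewrite (_ : x a = 0) ?mulr0//; apply/eqP; rewrite eq_le xa x0.
have [_ _ /(_ a xa)] := dual_slackness hx; rewrite ai => H.
by have := uk (server a); rewrite -H pmulr_rgt0// service_rate_gt0.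
Qed.

End dual.
End static_allocation.

(** * The queue length chain *)

Section chain.
Context {R : realType} {nI nK : nat} {S : parallel_server_system R nI nK}.
Implicit Types (a b : activity S) (z : state S) (c : activity S -> R).

Definition linear_functional c z : R := \sum_a c a * (z a)%:R.

Definition transition (j : activity S + activity S) z : state S :=
  match j with inl a => add_job z a | inr a => remove_job z a end.

Definition jump c (j : activity S + activity S) : R :=
  match j with inl a => c a | inr a => - c a end.

Lemma linear_functional_add_job c z a :
  linear_functional c (add_job z a) = linear_functional c z + c a.
Proof.
rewrite /linear_functional (eq_bigr (fun b => c b * (z b)%:R + c b * (b == a)%:R)).
  rewrite big_split/=; congr (_ + _); rewrite (bigD1 a)//= eqxx mulr1 big1 ?addr0//.
  by move=> b /negPf ->; rewrite mulr0.
by move=> b _; rewrite ffunE natrD mulrDr.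
Qed.

Lemma linear_functional_remove_job c z a : z a != 0%N ->
  linear_functional c (remove_job z a) = linear_functional c z - c a.
Proof.
move=> za0; apply/eqP; rewrite -subr_eq opprK -linear_functional_add_job.
apply/eqP; congr linear_functional; apply/ffunP => b; rewrite !ffunE.
by case: eqP => [->|_]; rewrite ?subn0 ?addn0// subnK// lt0n.
Qed.

Lemma linear_functional_ge0 c z : (forall a, 0 <= c a) -> 0 <= linear_functional c z.
Proof. by move=> c0; apply: sumr_ge0 => a _; rewrite mulr_ge0. Qed.

Lemma workloadE z k :
  workload z k = linear_functional (fun a => mean_service a * (server a == k)%:R) z.
Proof.
rewrite /workload big_mkcond; apply: eq_bigr => a _.
by case: eqP => _; rewrite ?mulr1// mulr0 mul0r.
Qed.

Lemma linear_functional_server (h : 'I_nK -> R) z :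
  linear_functional (fun a => mean_service a * h (server a)) z =
  \sum_k h k * workload z k.
Proof.
rewrite /linear_functional sum_by_server; apply: eq_bigr => k _.
by rewrite /workload mulr_sumr; apply: eq_bigr => a /eqP ->; ring.
Qed.

Lemma workload_ge0 z k : 0 <= workload z k.
Proof.
by apply: sumr_ge0 => a _; rewrite mulr_ge0// ltW// mean_service_gt0.
Qed.

Definition busy z k : R := (0 < \sum_(a | server a == k) z a)%N%:R.

Lemma busy_ge0_le1 z k : 0 <= busy z k <= 1.
Proof. by rewrite /busy; case: (0 < _)%N; rewrite ?lexx ?ler01. Qed.

Lemma workload_busy z k : workload z k * busy z k = workload z k.
Proof.
rewrite /busy; case: posnP => [|_]; last by rewrite mulr1.
move=> /eqP; rewrite sum_nat_eq0 => /forallP H.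
rewrite mulr0 /workload big1// => a ak.
by have /implyP/(_ ak)/eqP -> := H a; rewrite mulr0.
Qed.

Lemma wwtaP z : (forall i, exists a, job_class a = i) ->
  exists L : 'I_nI -> activity S, [/\ forall i, job_class (L i) = i,
    forall a, wwta z a = (a == L (job_class a)) &
    forall a, mean_service (L (job_class a)) * workload z (server (L (job_class a))) <=
      mean_service a * workload z (server a)].
Proof.
move=> ne.
have /choice[L LP] (i : 'I_nI) : exists a, job_class a = i /\ wwta z a.
  have [a0 a0i] := ne i.
  have a0i' : job_class a0 == i by apply/eqP.
  case: (@arg_minP _ _ _ a0 (fun a => job_class a == i)
    (fun a => mean_service a * workload z (server a)) a0i') => b bi bmin.
  have Pb : (job_class b == i) && in_argmin z b.
    rewrite bi; apply/forallP => e; apply/implyP => /eqP eb; apply: bmin.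
    by rewrite eb.
  case: (@arg_minnP _ b (fun a => (job_class a == i) && in_argmin z a)
    (fun a => server a : nat) Pb) => e /andP[/eqP ei ez] emin.
  exists e; split=> //; rewrite /wwta ez; apply/forallP => f; apply/implyP.
  by rewrite ei; exact: emin.
exists L; split=> [i|a|a]; first exact: (LP i).1.
  have [Li LW] := LP (job_class a).
  apply/idP/eqP => [aW|->//].
  have /andP[aA /forallP aS] := aW; have /andP[LA /forallP LS] := LW.
  have h1 : (server a <= server (L (job_class a)))%N.
    by have /implyP := aS (L (job_class a)); apply; rewrite Li eqxx.
  have h2 : (server (L (job_class a)) <= server a)%N.
    by have /implyP := LS a; apply; rewrite Li eqxx.
  have h3 : server a = server (L (job_class a)).
    by apply/val_inj/eqP; rewrite eqn_leq h1.
  apply: val_inj; rewrite [LHS]surjective_pairing [RHS]surjective_pairing.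
  by congr pair; [rewrite -[RHS]/(job_class _) Li|exact: h3].
have [Li /andP[/forallP LA _]] := LP (job_class a).
by have /implyP := LA a; apply; rewrite Li.
Qed.

(** * Transition rates and drifts of linear and quadratic functions *)

Variables (policy : state S -> activity S -> R) (r : R).
Hypothesis nonidling : nonidling_policy policy.
Hypothesis r01 : 0 < r < 1.

Definition transition_rate z (j : activity S + activity S) : R :=
  match j with
  | inl a => scaled_arrival_rate S r (job_class a) * (wwta z a)%:R
  | inr a => service_rate a * policy z a
  end.

Local Notation gen := (jump_generator transition_rate transition).

Lemma generatorE : generator policy r = gen.
Proof.
apply/funext => f; apply/funext => z; rewrite /generator /jump_generator.
rewrite big_sumType/=; congr (_ + _).
  rewrite sum_by_class; apply: eq_bigr => i _; rewrite mulr_sumr.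
  by apply: eq_bigr => a /eqP ->; ring.
by rewrite sum_by_server.
Qed.

Definition total_rate : R := \sum_i arrival_rate S i + \sum_(a : activity S) service_rate a.

Lemma transition_rate_ge0 z j : 0 <= transition_rate z j.
Proof.
have /andP[r0 r1] := r01; case: nonidling => P0 _ _.
case: j => a /=; last first.
  by have /andP[p0 _] := P0 z a; rewrite mulr_ge0// ltW// service_rate_gt0.
by rewrite !mulr_ge0 ?subr_ge0 ?(ltW r1)// ltW// arrival_rate_gt0.
Qed.

Lemma transition_rate_le z j : transition_rate z j <= total_rate.
Proof.
have /andP[r0 r1] := r01; case: nonidling => P0 _ _.
have l0 : 0 <= \sum_i arrival_rate S i.
  by apply: sumr_ge0 => i _; rewrite ltW// arrival_rate_gt0.
have m0 : 0 <= \sum_(a : activity S) service_rate a.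
  by apply: sumr_ge0 => a _; rewrite ltW// service_rate_gt0.
case: j => a /=.
  apply: (@le_trans _ _ (arrival_rate S (job_class a))); last first.
    rewrite /total_rate (bigD1 (job_class a))//= -addrA lerDl addr_ge0// sumr_ge0//.
    by move=> i _; rewrite ltW// arrival_rate_gt0.
  have := arrival_rate_gt0 S (job_class a); rewrite /scaled_arrival_rate.
  case: (wwta z a); rewrite ?mulr1 ?mulr0; nra.
apply: (@le_trans _ _ (service_rate a)).
  have /andP[_ p1] := P0 z a.
  by rewrite ler_piMr// ltW// service_rate_gt0.
rewrite /total_rate addrC (bigD1 a)//= -addrA lerDl addr_ge0// sumr_ge0//.
by move=> b _; rewrite ltW// service_rate_gt0.
Qed.

(** A departure of nonzero rate finds a nonempty buffer, so the truncated subtraction in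
    [remove_job] is exact. *)
Lemma linear_functional_transition c z j : transition_rate z j != 0 ->
  linear_functional c (transition j z) = linear_functional c z + jump c j.
Proof.
case: j => a /= q0; first exact: linear_functional_add_job.
apply: linear_functional_remove_job; apply: contra_neq q0 => za0.
by case: nonidling => _ -> //; rewrite mulr0.
Qed.

Lemma gen_eq (f : state S -> R) (D : activity S + activity S -> R) z :
  (forall j, transition_rate z j != 0 -> f (transition j z) - f z = D j) ->
  gen f z = \sum_j transition_rate z j * D j.
Proof.
move=> H; apply: eq_bigr => j _.
by have [->|/H ->//] := eqVneq (transition_rate z j) 0; rewrite !mul0r.
Qed.

(** The drift at [z] of the [h]-weighted workload with [h] frozen. For a quadratic function, [h] is
    taken to be half its gradient at [z], such as [workload z] or [deviation z]. *)
Definition server_drift (h : 'I_nK -> R) z : R :=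
  \sum_j transition_rate z j * jump (fun a => mean_service a * h (server a)) j.

Lemma sum_arrival_rate (g : activity S -> R) z (L : 'I_nI -> activity S) :
  (forall i, job_class (L i) = i) ->
  (forall a, wwta z a = (a == L (job_class a))) ->
  \sum_a transition_rate z (inl a) * g a =
  (1 - r) * \sum_i arrival_rate S i * g (L i).
Proof.
move=> Li LW; rewrite sum_by_class mulr_sumr; apply: eq_bigr => i _.
rewrite (bigD1 (L i)) ?Li//= LW Li eqxx mulr1 big1 ?addr0.
  by rewrite /scaled_arrival_rate; ring.
by move=> a /andP[/eqP ai /negPf aL]; rewrite LW ai aL mulr0 mul0r.
Qed.

(** The policy disappears here: effort on any class reduces the workload of the server at unit rate,
    so only the total effort counts, and non-idling fixes it to [busy z k]. *)
Lemma sum_departure_rate (h : 'I_nK -> R) z :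
  \sum_a transition_rate z (inr a) * (mean_service a * h (server a)) =
  \sum_k h k * busy z k.
Proof.
rewrite sum_by_server; apply: eq_bigr => k _.
have -> : busy z k = \sum_(a | server a == k) policy z a.
  rewrite /busy; case: nonidling => _ P0 P1; case: posnP => [|/P1 ->//].
  move=> /eqP; rewrite sum_nat_eq0 => /forallP H.
  by rewrite big1// => a ak; apply: P0; have /implyP/(_ ak)/eqP := H a.
rewrite mulr_sumr; apply: eq_bigr => a /eqP -> /=.
transitivity ((service_rate a * mean_service a) * (h k * policy z a)); first by ring.
by rewrite service_rateK mul1r.
Qed.

Lemma server_driftE (h : 'I_nK -> R) z (L : 'I_nI -> activity S) :
  (forall i, job_class (L i) = i) ->
  (forall a, wwta z a = (a == L (job_class a))) ->
  server_drift h z =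
  (1 - r) * \sum_i arrival_rate S i * (mean_service (L i) * h (server (L i))) -
  \sum_k h k * busy z k.
Proof.
move=> Li LW; rewrite /server_drift big_sumType/=; congr (_ + _).
  exact: (@sum_arrival_rate (fun a => mean_service a * h (server a))).
rewrite -sum_departure_rate -sumrN; apply: eq_bigr => a _ /=.
by rewrite mulrN.
Qed.

Lemma server_driftB (f g : 'I_nK -> R) (c : R) z :
  server_drift (fun k => f k - c * g k) z = server_drift f z - c * server_drift g z.
Proof.
rewrite /server_drift mulr_sumr -sumrB; apply: eq_bigr => -[] a _ /=; ring.
Qed.

Lemma gen_sum_sqr (h : 'I_nK -> 'I_nK -> R) z :
  let ell k := linear_functional (fun a => mean_service a * h k (server a)) in
  gen (fun z => \sum_k ell k z ^+ 2) z =
  2 * server_drift (fun l => \sum_k ell k z * h k l) z +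
  \sum_j transition_rate z j *
    \sum_k (jump (fun a => mean_service a * h k (server a)) j) ^+ 2.
Proof.
move=> ell; rewrite (@gen_eq _ (fun j => \sum_k
   (2 * ell k z * jump (fun a => mean_service a * h k (server a)) j +
    (jump (fun a => mean_service a * h k (server a)) j) ^+ 2))); last first.
  move=> j qj; rewrite -sumrB; apply: eq_bigr => k _.
  by rewrite /ell linear_functional_transition//; ring.
rewrite /server_drift mulr_sumr -big_split/=; apply: eq_bigr => j _.
rewrite big_split/= mulrDr; congr (_ + _).
rewrite mulrCA; congr (_ * _); case: j => a /=.
  by rewrite !mulr_sumr; apply: eq_bigr => k _; ring.
by rewrite !mulr_sumr -sumrN mulr_sumr; apply: eq_bigr => k _; ring.
Qed.

End chain.

(** * State space collapse and stationary moments *)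

Section estimates.
Context {R : realType} {nI nK : nat} {S : parallel_server_system R nI nK}.
Variables (v : 'I_nI -> R) (u : 'I_nK -> R).
Hypothesis rht : relaxed_heavy_traffic S.
Hypothesis rcrp : relaxed_complete_resource_pooling S.
Hypothesis dual : dual_optimal S v u.
Variable policy : state S -> activity S -> R.
Hypothesis nonidling : nonidling_policy policy.
Implicit Types (a b : activity S) (z : state S) (r : R).

Local Notation gen r := (jump_generator (transition_rate policy r) (@transition _ _ _ S)).

Definition weight a : R := mean_service a * u (server a).

Definition total_workload z : R := linear_functional weight z.

Definition norm2 : R := \sum_k u k ^+ 2.

(* The component of the workload vector orthogonal to [u]. *)
Definition deviation z k : R := workload z k - u k * (total_workload z / norm2).

Definition dispersion z : R := \sum_k `|deviation z k|.

Lemma u_gt0 k : 0 < u k. Proof. exact: (dual_gt0 rht dual rcrp).1. Qed.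

Lemma v_gt0 i : 0 < v i. Proof. exact: (dual_gt0 rht dual rcrp).2. Qed.

Lemma sum_u : \sum_k u k = 1.
Proof. by have [x hx] := rht; have [] := dual_slackness rht dual hx. Qed.

Lemma sum_v : \sum_i arrival_rate S i * v i = 1.
Proof. by have [x hx] := rht; have [] := dual_slackness rht dual hx. Qed.

Lemma norm2_gt0 : 0 < norm2.
Proof.
have [k] : exists k : 'I_nK, True.
  apply/not_existsP => H; have := sum_u; rewrite big1 => [/eqP|k _].
    by rewrite eq_sym oner_eq0.
  by case: (H k).
move=> _; rewrite /norm2 (bigD1 k)//= ltr_pwDl ?exprn_gt0 ?u_gt0//.
by apply: sumr_ge0 => l _; exact: sqr_ge0.
Qed.

Lemma weight_gt0 a : 0 < weight a.
Proof. by rewrite mulr_gt0 ?mean_service_gt0 ?u_gt0. Qed.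

Lemma v_le_weight a : v (job_class a) <= weight a.
Proof.
have [[_ vu _] _] := dual; have := ler_wpM2l (ltW (mean_service_gt0 a)) (vu a).
by rewrite mulrA [_ * service_rate a]mulrC service_rateK mul1r.
Qed.

Lemma weight_basic (x : activity S -> R) a : heavy_traffic_solution x -> 0 < x a ->
  weight a = v (job_class a).
Proof.
move=> hx xa; have [_ _ /(_ a xa)] := dual_slackness rht dual hx => H.
by rewrite /weight -H mulrA [_ * service_rate a]mulrC service_rateK mul1r.
Qed.

Lemma heavy_traffic_flow (x : activity S -> R) : heavy_traffic_solution x -> flow x.
Proof. by case=> -[[]]. Qed.

Lemma exists_activity i : exists a : activity S, job_class a = i.
Proof. by have [x hx] := rht; exact: flow_class (heavy_traffic_flow hx) i. Qed.

Lemma exists_basic (x : activity S -> R) i : flow x ->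
  exists2 a, job_class a = i & 0 < x a.
Proof.
move=> [x0 xi]; apply/not_exists2P => H; have := arrival_rate_gt0 S i.
rewrite -xi big1 ?ltxx// => a /eqP ai; have [//|/negP] := H a.
by rewrite -leNgt => xa; rewrite (_ : x a = 0) ?mulr0//; apply/eqP; rewrite eq_le xa x0.
Qed.

Lemma total_workloadE z : total_workload z = \sum_k u k * workload z k.
Proof. exact: linear_functional_server. Qed.

Lemma total_workload_ge0 z : 0 <= total_workload z.
Proof. by apply: linear_functional_ge0 => a; rewrite ltW// weight_gt0. Qed.

Lemma total_workload_le z : total_workload z <= \sum_k workload z k.
Proof.
rewrite total_workloadE; apply: ler_sum => k _.
rewrite ler_piMl ?workload_ge0// -sum_u (bigD1 k)//= lerDl.
by apply: sumr_ge0 => l _; rewrite ltW// u_gt0.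
Qed.

Lemma dispersion_ge0 z : 0 <= dispersion z.
Proof. exact: sumr_ge0. Qed.

Lemma deviation_le z k : `|deviation z k| <= dispersion z.
Proof. by rewrite /dispersion (bigD1 k)//= lerDl sumr_ge0. Qed.

Lemma sum_u_deviation z : \sum_k u k * deviation z k = 0.
Proof.
rewrite (eq_bigr (fun k => u k * workload z k -
    u k ^+ 2 * (total_workload z / norm2))); last first.
  by move=> k _; rewrite /deviation; ring.
rewrite sumrB -total_workloadE -mulr_suml -/norm2.
by rewrite mulrC divfK ?subrr// gt_eqF// norm2_gt0.
Qed.

Lemma sum_workload z :
  \sum_k workload z k = \sum_k deviation z k + total_workload z / norm2.
Proof.
rewrite -[X in _ + X]mul1r -sum_u mulr_suml -big_split/=.
by apply: eq_bigr => k _; rewrite subrK.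
Qed.

(* [C] depends on a chain of direct communications between each pair of
   servers: along a link through class [i], the two ratios [W_k / u_k] differ by
   at most a constant times the excess of [m_ik W_k] over its class minimum. *)
Lemma dispersion_le_excess (x : activity S -> R) :
  heavy_traffic_solution x ->
  (forall y a, heavy_traffic_solution y -> 0 < y a -> 0 < x a) ->
  exists2 C : R, 0 < C & forall z (mn : 'I_nI -> R),
    (forall a, mn (job_class a) <= mean_service a * workload z (server a)) ->
    dispersion z <= C * \sum_a service_rate a * x a *
      (mean_service a * workload z (server a) - mn (job_class a)).
Proof.
move=> hx xint.
pose ok z (mn : 'I_nI -> R) :=
  forall a, mn (job_class a) <= mean_service a * workload z (server a).
pose kap z (mn : 'I_nI -> R) := \sum_a service_rate a * x a *
      (mean_service a * workload z (server a) - mn (job_class a)).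
have [x0 _] := heavy_traffic_flow hx.
have term0 z mn a : ok z mn -> 0 <= service_rate a * x a *
      (mean_service a * workload z (server a) - mn (job_class a)).
  by move=> zmn; rewrite !mulr_ge0 ?subr_ge0// ltW// service_rate_gt0.
have kap_ge z mn a : ok z mn -> service_rate a * x a *
      (mean_service a * workload z (server a) - mn (job_class a)) <= kap z mn.
  move=> zmn; rewrite /kap (bigD1 a)//= lerDl sumr_ge0// => b _; exact: term0.
have kap0 z mn : ok z mn -> 0 <= kap z mn.
  by move=> zmn; apply: sumr_ge0 => a _; exact: term0.
pose Q k l := exists C : R, 0 <= C /\ forall z mn, ok z mn ->
  `|workload z k / u k - workload z l / u l| <= C * kap z mn.
have QA : forall k l, Q k l.
  apply: (communicate_ind rcrp).
  - by move=> k; exists 0; split=> // z mn _; rewrite subrr normr0 mul0r.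
  - move=> k l m [C1 [C10 H1]] [C2 [C20 H2]]; exists (C1 + C2); split.
      exact: addr_ge0.
    move=> z mn zmn; rewrite -(subrK (workload z l / u l) (workload z k / u k)) -addrA.
    apply: (le_trans (ler_normD _ _)); rewrite mulrDl.
    by apply: lerD; [exact: H1|exact: H2].
  move=> a b [y hy [ya yb]] ab.
  have xa := xint _ _ hy ya; have xb := xint _ _ hy yb.
  have sa := service_rate_gt0 a; have sb := service_rate_gt0 b.
  have vi := v_gt0 (job_class a).
  exists (((service_rate a * x a)^-1 + (service_rate b * x b)^-1) / v (job_class a)).
  split; first by rewrite divr_ge0 ?addr_ge0 ?invr_ge0 ?mulr_ge0// ltW.
  move=> z mn zmn.
  have E e : weight e = v (job_class e) ->
      mean_service e * workload z (server e) =
      v (job_class e) * (workload z (server e) / u (server e)).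
    by move=> <-; rewrite /weight; field; rewrite gt_eqF// u_gt0.
  have Ea := E _ (weight_basic hx xa); have Eb := E _ (weight_basic hx xb).
  rewrite mulrAC ler_pdivlMr// -[X in _ * X](gtr0_norm vi) -normrM mulrC mulrBr.
  rewrite -Ea [in X in _ - X]ab -Eb mulrDl.
  have Ha : mean_service a * workload z (server a) - mn (job_class a) <=
      (service_rate a * x a)^-1 * kap z mn.
    by rewrite ler_pdivlMl ?mulr_gt0//; exact: kap_ge.
  have Hb : mean_service b * workload z (server b) - mn (job_class a) <=
      (service_rate b * x b)^-1 * kap z mn.
    by rewrite ler_pdivlMl ?mulr_gt0// ab; exact: kap_ge.
  have := zmn a; have := zmn b; rewrite -ab => Na Nb.
  by rewrite ler_norml; apply/andP; split; lra.
have /choice[C CP] (kl : 'I_nK * 'I_nK) : exists C : R, 0 <= C /\ forall z mn, ok z mn ->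
  `|workload z kl.1 / u kl.1 - workload z kl.2 / u kl.2| <= C * kap z mn.
  exact: QA.
pose CM := \sum_kl C kl.
have CM0 : 0 <= CM by apply: sumr_ge0 => kl _; exact: (CP kl).1.
have CMP k l z mn : ok z mn ->
    `|workload z k / u k - workload z l / u l| <= CM * kap z mn.
  move=> zmn; apply: (le_trans ((CP (k, l)).2 z mn zmn)).
  rewrite ler_wpM2r ?kap0// /CM (bigD1 (k, l))//= lerDl.
  by apply: sumr_ge0 => kl _; exact: (CP kl).1.
exists (CM + 1); first by rewrite ltr_wpDl.
move=> z mn zmn; rewrite -/(kap z mn).
apply: (@le_trans _ _ (CM * kap z mn)); last by rewrite ler_wpM2r ?kap0// lerDl.
rewrite -[leRHS]mul1r -sum_u mulr_suml; apply: ler_sum => k _.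
have uk := u_gt0 k.
(* The deviation is [u k] times the mean, with weights [u l ^+ 2 / norm2], of the differences
   between the ratios workload over [u]; each difference is bounded along a chain of links. *)
have -> : deviation z k = u k *
    ((\sum_l u l ^+ 2 * (workload z k / u k - workload z l / u l)) / norm2).
  under eq_bigr do rewrite mulrBr.
  rewrite sumrB -mulr_suml -/norm2 /deviation total_workloadE.
  have -> : \sum_l u l ^+ 2 * (workload z l / u l) = \sum_l u l * workload z l.
    by apply: eq_bigr => l _; field; rewrite gt_eqF// u_gt0.
  by field; rewrite !gt_eqF// norm2_gt0.
rewrite normrM gtr0_norm// ler_pM2l// normrM normfV (gtr0_norm norm2_gt0).
rewrite ler_pdivrMr ?norm2_gt0//.
apply: (le_trans (ler_norm_sum _ _ _)); rewrite /norm2 mulr_sumr.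
apply: ler_sum => l _; rewrite normrM ger0_norm ?sqr_ge0// [leRHS]mulrC.
by rewrite ler_wpM2l ?sqr_ge0// CMP.
Qed.

(** Routing according to the optimal [x] would at full load balance service exactly. WWTA takes
    class minima instead, and the gap [kap] between the two dominates the dispersion. *)
Lemma server_drift_workload_le : exists2 c : R, 0 < c & forall r z, 0 < r < 1 ->
  server_drift policy r (workload z) z <=
  - ((1 - r) * c * dispersion z) - r * \sum_k workload z k.
Proof.
have [x hx xint] := heavy_traffic_interior rht.
have [C C0 CP] := dispersion_le_excess hx xint.
exists C^-1; first by rewrite invr_gt0.
move=> r z r01; have [L [Li LW Lmin]] := wwtaP z exists_activity.
rewrite (server_driftE r nonidling _ Li LW).
under [X in _ - X]eq_bigr do rewrite workload_busy.
pose mn i := mean_service (L i) * workload z (server (L i)).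
have := CP z mn Lmin.
have -> : \sum_a service_rate a * x a *
      (mean_service a * workload z (server a) - mn (job_class a)) =
    \sum_k workload z k - \sum_i arrival_rate S i * mn i.
  under eq_bigr do rewrite mulrBr.
  rewrite sumrB; congr (_ - _).
    rewrite sum_by_server; apply: eq_bigr => k _.
    have [_ x1] := hx; rewrite -[RHS]mul1r -(x1 k) mulr_suml.
    apply: eq_bigr => a /eqP ->.
    transitivity ((service_rate a * mean_service a) * (x a * workload z k)); first by ring.
    by rewrite service_rateK mul1r.
  have [_ xi] := heavy_traffic_flow hx.
  rewrite sum_by_class; apply: eq_bigr => i _; rewrite -(xi i) mulr_suml.
  by apply: eq_bigr => a /eqP ->.
set kap := \sum_k workload z k - \sum_i arrival_rate S i * mn i => H.
have {}H : C^-1 * dispersion z <= kap by rewrite ler_pdivrMl.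
have /andP[r0 r1] := r01; have r1' : 0 <= 1 - r by lra.
have := ler_wpM2l r1' H; rewrite /kap /mn; lra.
Qed.

(** The rate at which total workload is gained through idling and through arrivals sent to
    activities that are not dual-tight; [imbalanceE] exhibits the two parts. *)
Definition imbalance r z : R := r + server_drift policy r u z.

Lemma imbalanceE r z (L : 'I_nI -> activity S) :
  (forall i, job_class (L i) = i) ->
  (forall a, wwta z a = (a == L (job_class a))) ->
  imbalance r z =
  (1 - r) * \sum_i arrival_rate S i * (weight (L i) - v i) +
  \sum_k u k * (1 - busy z k).
Proof.
move=> Li LW; rewrite /imbalance (server_driftE r nonidling _ Li LW).
under [X in _ = _ * X + _]eq_bigr do rewrite mulrBr.
under [X in _ = _ + X]eq_bigr do rewrite mulrBr mulr1.
rewrite !sumrB sum_u sum_v; ring.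
Qed.

Lemma imbalance_ge0 r z : 0 < r < 1 -> 0 <= imbalance r z.
Proof.
move=> /andP[r0 r1]; have [L [Li LW Lmin]] := wwtaP z exists_activity.
rewrite (imbalanceE _ Li LW) addr_ge0//.
  rewrite mulr_ge0 ?subr_ge0 ?(ltW r1)// sumr_ge0// => i _.
  by rewrite mulr_ge0 ?(ltW (arrival_rate_gt0 _ _))// subr_ge0 -{1}(Li i) v_le_weight.
apply: sumr_ge0 => k _; rewrite mulr_ge0 ?(ltW (u_gt0 _))// subr_ge0.
by have /andP[] := busy_ge0_le1 z k.
Qed.

Lemma imbalance_le : exists2 C : R, 0 <= C & forall r z, 0 < r < 1 -> imbalance r z <= C.
Proof.
exists (\sum_i arrival_rate S i * \sum_a weight a + 1).
  rewrite addr_ge0// sumr_ge0// => i _; rewrite mulr_ge0 ?(ltW (arrival_rate_gt0 _ _))//.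
  by apply: sumr_ge0 => a _; rewrite ltW// weight_gt0.
move=> r z /andP[r0 r1]; have [L [Li LW Lmin]] := wwtaP z exists_activity.
rewrite (imbalanceE _ Li LW); apply: lerD; last first.
  rewrite -[leRHS]sum_u; apply: ler_sum => k _; rewrite ler_piMr ?(ltW (u_gt0 _))//.
  by rewrite lerBlDr lerDl; have /andP[] := busy_ge0_le1 z k.
have t0 i : 0 <= arrival_rate S i * (weight (L i) - v i).
  by rewrite mulr_ge0 ?(ltW (arrival_rate_gt0 _ _))// subr_ge0 -{1}(Li i) v_le_weight.
apply: (@le_trans _ _ (\sum_i arrival_rate S i * (weight (L i) - v i))).
  by rewrite ler_piMl ?sumr_ge0//; lra.
apply: ler_sum => i _; rewrite ler_pM2l ?arrival_rate_gt0//.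
apply: (@le_trans _ _ (weight (L i))); first by rewrite lerBlDr lerDl ltW// v_gt0.
rewrite (bigD1 (L i))//= lerDl sumr_ge0// => a _; by rewrite ltW// weight_gt0.
Qed.

(* Idling, or routing through an activity with [weight a > v (job_class a)], is
   possible only when the workload is far from the line spanned by [u]. *)
Lemma imbalance_dispersion : exists2 C : R, 0 <= C & forall r z, 0 < r < 1 ->
  imbalance r z != 0 -> total_workload z <= C * dispersion z.
Proof.
have [x hx] := rht; have fx := heavy_traffic_flow hx.
have U0 := norm2_gt0.
pose Ck k := norm2 / u k.
(* One constant per possible misrouting. If [weight p.1] equals [v], division by zero gives 0, a
   harmless term in the sum. *)
pose Ca (p : activity S * activity S) := norm2 * (mean_service p.1 + mean_service p.2) /
  `|weight p.1 - v (job_class p.1)|.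
have Ck0 k : 0 <= Ck k by rewrite divr_ge0// ltW// u_gt0.
have Ca0 p : 0 <= Ca p.
  by rewrite divr_ge0// mulr_ge0 ?addr_ge0 ?(ltW U0)// ltW// mean_service_gt0.
have CkS0 : 0 <= \sum_k Ck k by exact: sumr_ge0.
have CaS0 : 0 <= \sum_p Ca p by exact: sumr_ge0.
exists (\sum_k Ck k + \sum_p Ca p); first exact: addr_ge0.
move=> r z /andP[r0 r1]; have [L [Li LW Lmin]] := wwtaP z exists_activity.
rewrite (imbalanceE _ Li LW) => eta0.
have T0 := dispersion_ge0 z.
have [[k kidle]|nidle] := pselect (exists k, busy z k = 0).
  apply: (@le_trans _ _ (Ck k * dispersion z)); last first.
    rewrite ler_wpM2r// (bigD1 k)//= -addrA lerDl addr_ge0// sumr_ge0//.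
  (* An idle server has no workload, so its deviation is exactly
     [- u k * (total_workload z / norm2)]. *)
  have := deviation_le z k.
  rewrite /deviation -(workload_busy z k) kidle mulr0 sub0r normrN.
  rewrite ger0_norm; last first.
    by rewrite mulr_ge0 ?divr_ge0 ?total_workload_ge0 ?(ltW U0) ?(ltW (u_gt0 _)).
  rewrite mulrA ler_pdivrMr// => H.
  by rewrite /Ck mulrAC ler_pdivlMr ?u_gt0// mulrC [leRHS]mulrC.
have [[i Lne]|Leq] := pselect (exists i, weight (L i) != v i); last first.
  exfalso; move/eqP: eta0; apply.
  rewrite big1 ?mulr0 ?add0r; last first.
    move=> i _; have [->|ne] := eqVneq (weight (L i)) (v i); first by rewrite subrr mulr0.
    by case: Leq; exists i.
  apply: big1 => k _; rewrite /busy.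
  case: posnP => [H|_]; last by rewrite subrr mulr0.
  by case: nidle; exists k; rewrite /busy H.
(* WWTA preferred [L i] to the basic activity [b], although on the line spanned by [u] it is
   costlier by a multiple [weight (L i) - v i > 0] of the total workload; only the deviations can
   compensate for that. *)
have [b bi xb] := exists_basic i fx.
have wb := weight_basic hx xb; rewrite bi in wb.
have := Lmin b; rewrite bi => Lb.
apply: (@le_trans _ _ (Ca (L i, b) * dispersion z)); last first.
  rewrite ler_wpM2r// [X in _ <= _ + X](bigD1 (L i, b))//= addrCA lerDl addr_ge0// sumr_ge0//.
have e0 : 0 < weight (L i) - v i by rewrite subr_gt0 lt_neqAle eq_sym Lne -{1}(Li i) v_le_weight.
rewrite /Ca/= Li (gtr0_norm e0) mulrAC ler_pdivlMr//.
have WE k : workload z k = u k * (total_workload z / norm2) + deviation z k.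
  by rewrite addrC subrK.
rewrite !WE in Lb.
have da := deviation_le z (server (L i)); have db := deviation_le z (server b).
move: Lb da db; rewrite !ler_norml.
move: (deviation z (server (L i))) (deviation z (server b)) => D1 D2.
set Y := total_workload z / norm2; move=> Lb /andP[da1 da2] /andP[db1 db2].
have ma := ltW (mean_service_gt0 (L i)); have mb := ltW (mean_service_gt0 b).
have h1 := ler_wpM2l ma da1; have h2 := ler_wpM2l mb db2.
have h3 : weight (L i) * Y = mean_service (L i) * (u (server (L i)) * Y) by rewrite mulrA.
have h4 : v i * Y = mean_service b * (u (server b) * Y) by rewrite -wb mulrA.
have : Y * (weight (L i) - v i) <=
   (mean_service (L i) + mean_service b) * dispersion z by lra.
by rewrite /Y mulrAC ler_pdivrMr// => H; lra.
Qed.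

(** Entries of the orthogonal projection onto the complement of [u]; [sum_deviation_coef] says that
    it fixes the deviation. *)
Local Notation deviation_coef k l := ((l == k)%:R - u k * u l / norm2).

Lemma deviationE z k : deviation z k =
  linear_functional (fun a => mean_service a * deviation_coef k (server a)) z.
Proof.
rewrite /deviation workloadE /total_workload /linear_functional.
rewrite mulr_suml mulr_sumr -sumrB; apply: eq_bigr => a _.
by rewrite /weight; ring.
Qed.

Lemma sum_deviation_coef z l : \sum_k deviation z k * deviation_coef k l = deviation z l.
Proof.
under eq_bigr do rewrite mulrBr.
rewrite sumrB (bigD1 l)//= eqxx mulr1 big1 ?addr0; last first.
  by move=> k /negPf kl; rewrite eq_sym kl mulr0.
rewrite (eq_bigr (fun k => u k * deviation z k * (u l / norm2))); last first.
  by move=> k _; ring.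
by rewrite -mulr_suml sum_u_deviation mul0r subr0.
Qed.

(** The component along [u] is subtracted from the workload. Its drift is at least [- r] because the
    imbalance is nonnegative, and the resulting [r * total_workload z / norm2] cancels against the
    same term in [r * \sum_k workload z k]. What is left of order [r * dispersion z] is absorbed for
    small [r]. *)
Lemma server_drift_deviation_le : exists r0 c : R, [/\ 0 < r0 <= 1, 0 < c &
  forall r z, 0 < r < r0 -> server_drift policy r (deviation z) z <= - (c * dispersion z)].
Proof.
have [c c0 cP] := server_drift_workload_le.
exists (Num.min (1 / 2) (c / 4)), (c / 4); split.
- by rewrite lt_min !divr_gt0//= ge_min; apply/orP; left; lra.
- by rewrite divr_gt0.
move=> r z /andP[r0]; rewrite lt_min => /andP[r1 r2].
have r01 : 0 < r < 1 by apply/andP; split; lra.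
have -> : deviation z = fun k => workload z k - (total_workload z / norm2) * u k.
  by apply/funext => k; rewrite /deviation mulrC.
rewrite server_driftB.
have h1 := cP r z r01; rewrite sum_workload in h1.
have h2 := imbalance_ge0 z r01; rewrite /imbalance in h2.
have Y0 : 0 <= total_workload z / norm2.
  by rewrite divr_ge0 ?total_workload_ge0// ltW// norm2_gt0.
have h3 := ler_wpM2l Y0 h2.
have h4 : - \sum_k deviation z k <= dispersion z.
  apply: (le_trans (ler_norm _)); rewrite normrN; exact: ler_norm_sum.
have T0 := dispersion_ge0 z.
have h5 := ler_wpM2l (ltW r0) h4.
have h6 : r * dispersion z <= c / 4 * dispersion z by rewrite ler_wpM2r// ltW.
have h7 : c / 2 * dispersion z <= (1 - r) * c * dispersion z.
  by rewrite ler_wpM2r// mulrC ler_wpM2r ?ltW//; lra.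
lra.
Qed.

Lemma norm_jump_le : exists2 B : R, 0 <= B & forall k j,
  `|jump (fun a => mean_service a * deviation_coef k (server a)) j| <= B.
Proof.
exists (\sum_k \sum_(a : activity S) `|mean_service a * deviation_coef k (server a)|).
  by apply: sumr_ge0 => k _; exact: sumr_ge0.
move=> k j; rewrite (bigD1 k)//=.
case: j => a /=; rewrite ?normrN (bigD1 a)//= -addrA lerDl addr_ge0// sumr_ge0// => *;
  exact: sumr_ge0.
Qed.

Definition sqr_deviation z : R := \sum_k deviation z k ^+ 2.

Lemma sqr_deviation_le z : sqr_deviation z <= dispersion z ^+ 2.
Proof.
rewrite expr2 /dispersion mulr_suml; apply: ler_sum => k _.
rewrite -(real_normK (num_real (deviation z k))) expr2 ler_wpM2l//.
exact: deviation_le.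
Qed.

Lemma sqr_dispersion_le z : dispersion z ^+ 2 <= nK%:R * sqr_deviation z.
Proof.
have -> : dispersion z ^+ 2 = \sum_k \sum_l `|deviation z k| * `|deviation z l|.
  by rewrite expr2 /dispersion mulr_suml; apply: eq_bigr => k _; rewrite mulr_sumr.
apply: (@le_trans _ _ (\sum_(k < nK) \sum_(l < nK)
    (deviation z k ^+ 2 / 2 + deviation z l ^+ 2 / 2))).
  apply: ler_sum => k _; apply: ler_sum => l _.
  have := sqr_ge0 (`|deviation z k| - `|deviation z l|).
  rewrite -(real_normK (num_real (deviation z k))).
  rewrite -(real_normK (num_real (deviation z l))); nra.
rewrite le_eqVlt; apply/orP; left; apply/eqP.
under eq_bigr do rewrite big_split/=.
rewrite big_split/=.
have -> : \sum_(k < nK) \sum_(l < nK) deviation z l ^+ 2 / 2 =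
    nK%:R * (sqr_deviation z / 2).
  by rewrite sumr_const card_ord mulr_natl -mulr_suml.
have -> : \sum_(k < nK) \sum_(l < nK) deviation z k ^+ 2 / 2 =
    nK%:R * (sqr_deviation z / 2).
  rewrite exchange_big/= sumr_const card_ord mulr_natl -mulr_suml//.
by field.
Qed.

Lemma total_rate_ge0 : 0 <= total_rate (S := S).
Proof.
by rewrite addr_ge0// sumr_ge0// => ? _; rewrite ltW// ?arrival_rate_gt0 ?service_rate_gt0.
Qed.

(** * Lyapunov drift bounds and stationary moments *)

Lemma gen_sqr_workload_le : exists2 C : R, 0 <= C & forall r z, 0 < r < 1 ->
  gen r (fun z => \sum_k workload z k ^+ 2) z <= - (2 * r * \sum_k workload z k) + C.
Proof.
have [c c0 cP] := server_drift_workload_le.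
pose B := \sum_(k < nK) \sum_(a : activity S) mean_service a ^+ 2.
have B0 : 0 <= B by apply: sumr_ge0 => k _; apply: sumr_ge0 => a _; exact: sqr_ge0.
exists (#|{: activity S + activity S}|%:R * (total_rate (S := S) * B)).
  by rewrite !mulr_ge0// total_rate_ge0.
move=> r z r01.
have -> : (fun z => \sum_k workload z k ^+ 2) = (fun z => \sum_k
    linear_functional (fun a => mean_service a * (server a == k)%:R) z ^+ 2).
  by apply/funext => y; apply: eq_bigr => k _; rewrite workloadE.
rewrite (gen_sum_sqr r nonidling (fun k l => (l == k)%:R)); apply: lerD; last first.
  apply: sum_rates_le => //.
  - exact: transition_rate_ge0.
  - exact: transition_rate_le.
  - move=> j; apply: ler_sum => k _.
    by case: j => a /=; rewrite ?sqrrN (bigD1 a)//= exprMn -[leLHS]addr0;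
      (apply: lerD; last (by apply: sumr_ge0 => b _; exact: sqr_ge0));
      rewrite ler_piMr ?sqr_ge0//; case: eqP => _; rewrite ?expr1n ?expr0n ?ler01.
have -> : (fun l => \sum_k linear_functional
    (fun a => mean_service a * (server a == k)%:R) z * (l == k)%:R) = workload z.
  apply/funext => l; rewrite (bigD1 l)//= eqxx mulr1 -workloadE big1 ?addr0// => k.
  by rewrite eq_sym => /negPf ->; rewrite mulr0.
have := cP r z r01; have T0 := dispersion_ge0 z; have /andP[r0 r1] := r01.
have : 0 <= (1 - r) * c * dispersion z by rewrite !mulr_ge0 ?(ltW c0)//; lra.
by lra.
Qed.

Lemma cubic_bound (c A B : R) : 0 < c -> 0 <= A -> 0 <= B ->
  exists2 C : R, 0 <= C & forall t, 0 <= t ->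
    - (c * t ^+ 3) + A * t ^+ 2 + B * (t + 1) ^+ 2 <= - t ^+ 2 + C.
Proof.
move=> c0 A0 B0; pose D := A + 2 * B + 1.
have D0 : 0 <= D by rewrite /D; lra.
have E0 : 0 <= D * (D / c) ^+ 2 + 2 * B.
  by apply: addr_ge0; [exact: mulr_ge0 D0 (sqr_ge0 _)|lra].
exists (D * (D / c) ^+ 2 + 2 * B) => //.
move=> t t0.
have h1 : (t + 1) ^+ 2 <= 2 * t ^+ 2 + 2 by have := sqr_ge0 (t - 1); lra.
have h2 := ler_wpM2l B0 h1.
suff : D * t ^+ 2 <= c * t ^+ 3 + D * (D / c) ^+ 2 by rewrite /D; lra.
(* Beyond [D / c] the cubic term dominates [D * t ^+ 2]; below it, the constant does. *)
have t2 : 0 <= t ^+ 2 := sqr_ge0 t.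
have [tD|tD] := leP t (D / c).
  apply: (@le_trans _ _ (D * (D / c) ^+ 2)).
    by rewrite ler_wpM2l// lerXn2r// ?nnegrE// (le_trans t0).
  by rewrite lerDr mulr_ge0 ?(ltW c0)// exprn_ge0.
apply: (@le_trans _ _ (c * t ^+ 3)); last by rewrite lerDl mulr_ge0 ?sqr_ge0.
rewrite [t ^+ 3]exprS [leRHS]mulrA ler_wpM2r//; move: tD; rewrite ltr_pdivrMr// mulrC; exact: ltW.
Qed.

(** Write V for [sqr_deviation] and T for [dispersion]. The generator of V^2 is 2 V times that of V,
    plus the mean square of the jumps of V. The first is at most of order - T^3 + T^2, since V is
    comparable to T^2 and its drift is at most a constant minus a multiple of T; the jumps of V are
    O(T + 1). [cubic_bound] combines the terms. *)
Lemma gen_sqr_sqr_deviation_le : exists r0 C : R, [/\ 0 < r0 <= 1, 0 <= C &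
  forall r z, 0 < r < r0 ->
    gen r (fun z => sqr_deviation z ^+ 2) z <= - dispersion z ^+ 2 + C].
Proof.
have [r0 [c [/andP[r00 r01] c0 cP]]] := server_drift_deviation_le.
have [B B0 BP] := norm_jump_le.
pose B1 := 2 * B + nK%:R * B ^+ 2.
have B10 : 0 <= B1 by rewrite addr_ge0 ?mulr_ge0// sqr_ge0.
pose N := #|{: activity S + activity S}|%:R : R.
pose Lam := total_rate (S := S).
have Lam0 : 0 <= Lam := total_rate_ge0.
pose C0 := N * (Lam * (nK%:R * B ^+ 2)).
have C00 : 0 <= C0 by rewrite !mulr_ge0// sqr_ge0.
have nK0 : 0 < nK%:R :> R.
  rewrite ltr0n lt0n; apply/negP => /eqP nK_eq0.
  have := sum_u; rewrite big1 => [/eqP|k]; first by rewrite eq_sym oner_eq0.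
  by have := leq_ltn_trans (leq0n k) (ltn_ord k); rewrite nK_eq0.
have [C C_ge0 CP] := @cubic_bound (4 * c / nK%:R) (2 * C0) (N * (Lam * B1 ^+ 2))
  ltac:(by rewrite divr_gt0// mulr_gt0) ltac:(by rewrite mulr_ge0)
  ltac:(by rewrite !mulr_ge0// sqr_ge0).
exists r0, C; split=> //; first by rewrite r00.
move=> r z rr; have r1 : 0 < r < 1 by apply/andP; split; lra.
have T0 := dispersion_ge0 z.
have V0 : 0 <= sqr_deviation z by apply: sumr_ge0 => k _; exact: sqr_ge0.
pose jmp k j := jump (fun a => mean_service a * deviation_coef k (server a)) j.
pose D j := \sum_k (2 * deviation z k * jmp k j + jmp k j ^+ 2).
have DE j : transition_rate policy r z j != 0 ->
    sqr_deviation (transition j z) = sqr_deviation z + D j.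
  move=> qj; rewrite /sqr_deviation /D -big_split/=; apply: eq_bigr => k _.
  by rewrite !deviationE (linear_functional_transition nonidling _ qj) /jmp; ring.
have jB k j : jmp k j ^+ 2 <= B ^+ 2.
  by rewrite -(real_normK (num_real (jmp k j))) lerXn2r ?nnegrE// BP.
have Dle j : `|D j| <= B1 * (dispersion z + 1).
  apply: (le_trans (ler_norm_sum _ _ _)).
  apply: (@le_trans _ _ (\sum_(k < nK) (2 * B * `|deviation z k| + B ^+ 2))).
    apply: ler_sum => k _; apply: (le_trans (ler_normD _ _)); apply: lerD.
      rewrite !normrM ger0_norm// mulrAC ler_wpM2r// ler_wpM2l//; exact: BP.
    by rewrite ger0_norm ?sqr_ge0.
  rewrite big_split/= -mulr_sumr -/(dispersion z) sumr_const card_ord -mulr_natl.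
  have : 0 <= nK%:R * B ^+ 2 * dispersion z by rewrite !mulr_ge0// sqr_ge0.
  rewrite /B1; have := B0; lra.
have GV : \sum_j transition_rate policy r z j * D j <= - (2 * c * dispersion z) + C0.
  have := gen_sum_sqr r nonidling (fun k l => deviation_coef k l) z.
  rewrite /= (@gen_eq _ _ _ _ _ _ _ D); last first.
    move=> j qj; rewrite -[X in X - _](_ : sqr_deviation (transition j z) = _); last first.
      by apply: eq_bigr => k _; rewrite deviationE.
    rewrite -[X in _ - X](_ : sqr_deviation z = _); last first.
      by apply: eq_bigr => k _; rewrite deviationE.
    by rewrite DE// addrC addKr.
  move=> ->.
  have -> : (fun l => \sum_k linear_functional
    (fun a => mean_service a * deviation_coef k (server a)) z * deviation_coef k l) =
    deviation z.
    apply/funext => l; rewrite -[RHS]sum_deviation_coef.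
    by apply: eq_bigr => k _; rewrite -deviationE.
  apply: lerD; first by have := cP r z rr; lra.
  apply: sum_rates_le => //.
  - exact: transition_rate_ge0.
  - exact: transition_rate_le.
  - by rewrite mulr_ge0// sqr_ge0.
  - move=> j; apply: (@le_trans _ _ (\sum_(k < nK) B ^+ 2)).
      by apply: ler_sum => k _; exact: jB.
    by rewrite sumr_const card_ord mulr_natl.
rewrite (@gen_eq _ _ _ _ _ _ _ (fun j => 2 * sqr_deviation z * D j + D j ^+ 2)); last first.
  by move=> j qj; rewrite DE//; ring.
have -> : \sum_j transition_rate policy r z j * (2 * sqr_deviation z * D j + D j ^+ 2) =
  2 * sqr_deviation z * (\sum_j transition_rate policy r z j * D j) +
  \sum_j transition_rate policy r z j * D j ^+ 2.
  by rewrite mulr_sumr -big_split/=; apply: eq_bigr => j _; ring.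
have D2 : \sum_j transition_rate policy r z j * D j ^+ 2 <=
    N * (Lam * B1 ^+ 2) * (dispersion z + 1) ^+ 2.
  have -> : N * (Lam * B1 ^+ 2) * (dispersion z + 1) ^+ 2 =
    N * (Lam * (B1 * (dispersion z + 1)) ^+ 2) by ring.
  apply: sum_rates_le => //.
  - exact: transition_rate_ge0.
  - exact: transition_rate_le.
  - exact: sqr_ge0.
  - move=> j; rewrite -(real_normK (num_real (D j))) lerXn2r ?nnegrE//.
    by rewrite mulr_ge0// addr_ge0.
apply: le_trans (CP _ T0); rewrite -addrA addrA.
apply: lerD => //.
have h1 := ler_wpM2l (mulr_ge0 (ler0n R 2) V0) GV.
apply: (le_trans h1).
have h2 : C0 * sqr_deviation z <= C0 * dispersion z ^+ 2.
  by rewrite ler_wpM2l// sqr_deviation_le.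
have h3 : c / nK%:R * dispersion z * dispersion z ^+ 2 <=
    c / nK%:R * dispersion z * (nK%:R * sqr_deviation z).
  by rewrite ler_wpM2l ?sqr_dispersion_le// mulr_ge0// divr_ge0// ltW.
have h4 : c / nK%:R * dispersion z * (nK%:R * sqr_deviation z) =
    c * dispersion z * sqr_deviation z by field; rewrite gt_eqF.
rewrite h4 in h3; move: h2 h3; rewrite exprS; lra.
Qed.

Definition invariant r (pi : probability (state S) R) : Prop :=
  forall (f : state S -> R) B, (forall z, `|f z| <= B) -> \int[pi]_z gen r f z = 0.

Lemma foster_state r (pi : probability (state S) R) (V phi : state S -> R) (C : R) :
  0 < r < 1 -> invariant r pi -> 0 <= C ->
  (forall z, 0 <= V z) -> (forall z, 0 <= phi z) ->
  (forall z, gen r V z <= - phi z + C) ->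
  pi.-integrable setT (EFin \o phi) /\ \int[pi]_z phi z <= C.
Proof.
move=> r01 inv; apply: (@foster_bound _ _ _ _ _ _ total_rate) => //.
- exact: transition_rate_ge0.
- exact: transition_rate_le.
Qed.

Lemma integrable_dominated (pi : probability (state S) R) (f g : state S -> R) :
  pi.-integrable setT (EFin \o g) -> (forall z, `|f z| <= g z) ->
  pi.-integrable setT (EFin \o f).
Proof.
move=> ig fg; apply: le_integrable ig => //=.
by move=> z _; rewrite lee_fin (le_trans (fg z))// ler_norm.
Qed.

Lemma total_workload_moment : exists2 C : R, 0 <= C &
  forall r (pi : probability (state S) R), 0 < r < 1 -> invariant r pi ->
  pi.-integrable setT (EFin \o total_workload) /\
  r * \int[pi]_z total_workload z <= C.
Proof.
have [C C0 CP] := gen_sqr_workload_le.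
exists C => // r pi r01 inv; have /andP[r0 r1] := r01.
have W0 z : 0 <= \sum_k workload z k by apply: sumr_ge0 => k _; exact: workload_ge0.
have [iphi le_C] := @foster_state r pi (fun z => \sum_k workload z k ^+ 2)
  (fun z => 2 * r * \sum_k workload z k) C r01 inv C0
  ltac:(by move=> z; apply: sumr_ge0 => k _; exact: sqr_ge0)
  ltac:(by move=> z; rewrite !mulr_ge0// ltW) ltac:(by move=> z; exact: CP).
have le z : r * total_workload z <= 2 * r * \sum_k workload z k.
  have := ler_wpM2l (ltW r0) (total_workload_le z).
  by have := mulr_ge0 (ltW r0) (W0 z); lra.
have iY : pi.-integrable setT (EFin \o total_workload).
  have : pi.-integrable setT (EFin \o (fun z => r^-1 * (2 * r * \sum_k workload z k))).
    exact: (integrableZl _ r^-1 iphi).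
  move=> /integrable_dominated; apply=> z.
  by rewrite ger0_norm ?total_workload_ge0// ler_pdivlMl.
split=> //; apply: le_trans le_C; rewrite -RintegralZl//.
by apply: le_Rintegral => //; exact: (integrableZl _ r iY).
Qed.

Lemma dispersion_moment : exists r0 C : R, [/\ 0 < r0 <= 1, 0 <= C &
  forall r (pi : probability (state S) R), 0 < r < r0 -> invariant r pi ->
  pi.-integrable setT (EFin \o (fun z => dispersion z ^+ 2)) /\
  \int[pi]_z dispersion z ^+ 2 <= C].
Proof.
have [r0 [C [r01 C0 CP]]] := gen_sqr_sqr_deviation_le.
exists r0, C; split=> // r pi rr inv; have /andP[? ?] := r01; have /andP[? ?] := rr.
apply: (@foster_state r pi (fun z => sqr_deviation z ^+ 2)) => //.
- by apply/andP; split; lra.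
- by move=> z; exact: sqr_ge0.
- by move=> z; exact: sqr_ge0.
- by move=> z; exact: CP.
Qed.

(** * Laplace transform of the total workload *)

Lemma ln1D_le (x : R) : 0 <= x -> ln (1 + x) <= x.
Proof. by move=> x0; rewrite -ler_expR lnK ?expR_ge1Dx// posrE; lra. Qed.

Lemma ln1D_ge (x : R) : 0 <= x -> x - x ^+ 2 <= ln (1 + x).
Proof.
move=> x0; have x1 : 0 < 1 + x by lra.
have : ln ((1 + x)^-1) <= (1 + x)^-1 - 1.
  rewrite -ler_expR lnK ?posrE ?invr_gt0//.
  by have := expR_ge1Dx ((1 + x)^-1 - 1); lra.
rewrite lnV ?posrE// => H.
have : 1 - (1 + x)^-1 = x / (1 + x) by field; rewrite gt_eqF.
have : x - x ^+ 2 <= x / (1 + x) by rewrite ler_pdivlMr//; nra.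
lra.
Qed.

(* Departures change this function by exactly [sigma * weight a] times itself,
   so its generator has no second-order departure term; the policy-dependent
   contribution of the service effort cancels. *)
Definition test_function (sigma : R) z : R :=
  expR (- linear_functional (fun a => ln (1 + sigma * weight a)) z).

(** An arrival multiplies the test function by [(1 + sigma * w)^-1 = 1 - sigma * w + sigma ^+ 2 * (w
    ^+ 2 / (1 + sigma * w))], where [w] is its weight; this sum collects the last terms. *)
Definition arrival_variance (sigma r : R) z : R :=
  \sum_a transition_rate policy r z (inl a) *
    (weight a ^+ 2 / (1 + sigma * weight a)).

Lemma weight1D_gt0 (sigma : R) a : 0 < sigma -> 0 < 1 + sigma * weight a.
Proof. by move=> s0; rewrite addr_gt0// mulr_gt0// weight_gt0. Qed.

Lemma gen_test_function (sigma r : R) z : 0 < sigma ->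
  gen r (test_function sigma) z = sigma * (test_function sigma z *
    ((r - imbalance r z) + sigma * arrival_variance sigma r z)).
Proof.
move=> s0; set F := test_function sigma.
rewrite (@gen_eq _ _ _ _ _ _ _ (fun j => F z * match j with
   | inl a => (1 + sigma * weight a)^-1 - 1 | inr a => sigma * weight a end)).
  rewrite /imbalance opprD addNKr /server_drift /arrival_variance.
  rewrite !big_sumType/= opprD.
  rewrite !mulrDr !mulr_sumr -!sumrN addrAC -!big_split/= !mulr_sumr -!big_split/=.
  apply: eq_bigr => a _; rewrite -/(weight a).
  by field; rewrite gt_eqF// weight1D_gt0.
move=> j qj; rewrite /F /test_function (linear_functional_transition nonidling _ qj).
rewrite opprD expRD -[X in _ - X]mulr1 -mulrBr; congr (_ * _).
case: j {qj} => a /=; first by rewrite expRN lnK// posrE weight1D_gt0.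
by rewrite opprK lnK ?posrE ?weight1D_gt0// addrC addKr.
Qed.

Lemma test_function_ge0_le1 (sigma : R) z : 0 < sigma ->
  0 <= test_function sigma z <= 1.
Proof.
move=> s0; rewrite /test_function expR_ge0/= -[leRHS]expR0 ler_expR oppr_le0.
apply: linear_functional_ge0 => a; apply: ln_ge0.
by rewrite lerDl mulr_ge0 ?(ltW s0)// ltW// weight_gt0.
Qed.

Lemma log_test_function_le (sigma : R) z : 0 < sigma ->
  linear_functional (fun a => ln (1 + sigma * weight a)) z <= sigma * total_workload z.
Proof.
move=> s0; rewrite /total_workload /linear_functional mulr_sumr.
apply: ler_sum => a _; rewrite mulrA ler_wpM2r// ln1D_le//.
by rewrite mulr_ge0 ?(ltW s0)// ltW// weight_gt0.
Qed.

Lemma onem_test_function_le (sigma : R) z : 0 < sigma ->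
  1 - test_function sigma z <= sigma * total_workload z.
Proof.
move=> s0; apply: le_trans (log_test_function_le z s0).
by have := expR_ge1Dx (- linear_functional (fun a => ln (1 + sigma * weight a)) z);
  rewrite /test_function; lra.
Qed.

(** Both exponents are nonpositive, so the difference is at most that of the exponents, which
    [x - x ^+ 2 <= ln (1 + x) <= x] controls term by term. *)
Lemma test_function_exp (sigma : R) z : 0 < sigma ->
  `|test_function sigma z - expR (- (sigma * total_workload z))| <=
  sigma ^+ 2 * (\sum_a weight a) * total_workload z.
Proof.
move=> s0; rewrite /test_function; set l := linear_functional _ z.
have lY : l <= sigma * total_workload z := log_test_function_le z s0.
have F1 : expR (- l) <= 1 by have /andP[] := test_function_ge0_le1 z s0.
rewrite ger0_norm; last by rewrite subr_ge0 ler_expR lerN2.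
have -> : expR (- (sigma * total_workload z)) =
    expR (- l) * expR (- (sigma * total_workload z - l)).
  by rewrite -expRD; congr expR; ring.
apply: (@le_trans _ _ (sigma * total_workload z - l)).
  have := expR_ge1Dx (- (sigma * total_workload z - l)).
  have := expR_ge0 (- l).
  set e := expR (- (_ - l)); set p := expR (- l) in F1 *.
  have e1 : e <= 1 by rewrite /e -expR0 ler_expR oppr_le0 subr_ge0.
  move=> h1 h2; have : p * (1 - e) <= 1 * (1 - e) by rewrite ler_wpM2r// subr_ge0.
  lra.
rewrite /l /total_workload /linear_functional [X in X - _]mulr_sumr -sumrB [leRHS]mulr_sumr.
apply: ler_sum => a _; rewrite mulrA -mulrBl mulrA ler_wpM2r//.
have w0 := weight_gt0 a.
have sw0 : 0 <= sigma * weight a by rewrite mulr_ge0// ltW.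
have := ln1D_ge sw0.
have : (sigma * weight a) ^+ 2 <= sigma ^+ 2 * (\sum_b weight b) * weight a.
  rewrite exprMn expr2 [weight a ^+ 2]expr2 -!expr2 -mulrA ler_wpM2l ?sqr_ge0//.
  rewrite [weight a ^+ 2]expr2 ler_wpM2r ?(ltW w0)// (bigD1 a)//= lerDl.
  by apply: sumr_ge0 => b _; rewrite ltW// weight_gt0.
lra.
Qed.

Definition variance_constant : R := \sum_i arrival_rate S i * v i ^+ 2.

Lemma variance_constant_gt0 : 0 < variance_constant.
Proof.
have [i] : exists i : 'I_nI, True.
  apply/not_existsP => H; have := sum_v; rewrite big1 => [/eqP|i _].
    by rewrite eq_sym oner_eq0.
  by case: (H i).
move=> _; rewrite /variance_constant (bigD1 i)//= ltr_pwDl//.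
  by rewrite mulr_gt0 ?exprn_gt0 ?v_gt0// arrival_rate_gt0.
by apply: sumr_ge0 => l _; rewrite mulr_ge0 ?sqr_ge0// ltW// arrival_rate_gt0.
Qed.

(** Above: [weight ^+ 2 - v ^+ 2 <= 2 * B * (weight - v)], and the excess weights are part of the
    imbalance. Below: [v <= weight] and [1 / (1 + x) >= 1 - x]. *)
Lemma arrival_variance_dist : exists2 C : R, 0 <= C & forall sigma r z,
  0 < sigma -> 0 < r < 1 ->
  `|arrival_variance sigma r z - variance_constant| <=
  C * (imbalance r z + r + sigma).
Proof.
set B := \sum_a weight a; set Lam := \sum_i arrival_rate S i.
have wB a : weight a <= B.
  rewrite /B (bigD1 a)//= lerDl; apply: sumr_ge0 => b _.
  by rewrite ltW// weight_gt0.
have B0 : 0 <= B by apply: sumr_ge0 => b _; rewrite ltW// weight_gt0.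
have Lam0 : 0 <= Lam by apply: sumr_ge0 => i _; rewrite ltW// arrival_rate_gt0.
have m0 := variance_constant_gt0.
have LB0 : 0 <= Lam * B ^+ 3 by rewrite mulr_ge0// exprn_ge0.
exists (2 * B + variance_constant + Lam * B ^+ 3).
  by rewrite !addr_ge0 ?mulr_ge0 ?(ltW m0).
move=> sigma r z s0 r01; have /andP[r0 r1] := r01.
have [L [Li LW Lmin]] := wwtaP z exists_activity.
have eta0 := imbalance_ge0 z r01.
rewrite /arrival_variance (sum_arrival_rate _ _ _ Li LW).
have lam0 i := ltW (arrival_rate_gt0 S i).
have vw i : v i <= weight (L i) by rewrite -{1}(Li i) v_le_weight.
have up : (1 - r) * \sum_i arrival_rate S i *
    (weight (L i) ^+ 2 / (1 + sigma * weight (L i))) <=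
    variance_constant + 2 * B * imbalance r z.
  have h1 : (1 - r) * \sum_i arrival_rate S i * (weight (L i) - v i) <= imbalance r z.
    rewrite (imbalanceE _ Li LW) lerDl sumr_ge0// => k _.
    rewrite mulr_ge0 ?(ltW (u_gt0 _))// subr_ge0.
    by have /andP[] := busy_ge0_le1 z k.
  have B20 : 0 <= 2 * B by rewrite mulr_ge0.
  apply: (@le_trans _ _ (variance_constant + 2 * B * ((1 - r) *
      \sum_i arrival_rate S i * (weight (L i) - v i)))); last first.
    by rewrite lerD2l ler_wpM2l.
  have h2 : (1 - r) * variance_constant <= variance_constant by nra.
  apply: le_trans (lerD h2 (lexx _)).
  rewrite mulrCA -mulrDr ler_wpM2l ?subr_ge0 ?(ltW r1)//.
  rewrite mulr_sumr -big_split/=; apply: ler_sum => i _.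
  rewrite [2 * B * _]mulrCA -mulrDr ler_wpM2l//.
  apply: (@le_trans _ _ (weight (L i) ^+ 2)).
    rewrite ler_pdivrMr ?weight1D_gt0// ler_peMr ?sqr_ge0//.
    by rewrite lerDl mulr_ge0 ?(ltW s0)// ltW// weight_gt0.
  have := wB (L i); have := vw i; have := v_gt0 i; nra.
have lo : variance_constant - r * variance_constant - sigma * (Lam * B ^+ 3) <=
    (1 - r) * \sum_i arrival_rate S i *
    (weight (L i) ^+ 2 / (1 + sigma * weight (L i))).
  have h1 : (1 - r) * (sigma * (Lam * B ^+ 3)) <= sigma * (Lam * B ^+ 3).
    by rewrite ler_piMl ?mulr_ge0 ?(ltW s0)//; lra.
  apply: (@le_trans _ _ ((1 - r) * (variance_constant - sigma * (Lam * B ^+ 3)))).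
    by lra.
  rewrite ler_wpM2l ?subr_ge0 ?(ltW r1)//.
  rewrite mulrCA /Lam mulr_suml -sumrB; apply: ler_sum => i _.
  rewrite -mulrBr ler_wpM2l//.
  apply: (@le_trans _ _ (weight (L i) ^+ 2 - sigma * weight (L i) ^+ 3)).
    apply: lerB; first by rewrite lerXn2r// ?nnegrE ?(ltW (v_gt0 _))// ltW// weight_gt0.
    by rewrite ler_wpM2l ?(ltW s0)// lerXn2r ?nnegrE// ltW// weight_gt0.
  rewrite ler_pdivlMr ?weight1D_gt0//.
  have w0 := weight_gt0 (L i).
  have : 0 <= sigma ^+ 2 * weight (L i) ^+ 4 by rewrite mulr_ge0 ?sqr_ge0// exprn_ge0// ltW.
  lra.
rewrite ler_distl; apply/andP; split.
  have := mulr_ge0 B0 eta0; have := mulr_ge0 (ltW m0) eta0.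
  have := mulr_ge0 LB0 eta0; have := mulr_ge0 LB0 (ltW r0).
  have := mulr_ge0 B0 (ltW r0); have := mulr_ge0 B0 (ltW s0).
  have := mulr_ge0 (ltW m0) (ltW s0).
  move: lo; set l := (1 - r) * _; lra.
have := mulr_ge0 (ltW m0) eta0.
have := mulr_ge0 LB0 eta0; have := mulr_ge0 LB0 (ltW r0).
have := mulr_ge0 B0 (ltW r0); have := mulr_ge0 B0 (ltW s0).
have := mulr_ge0 (ltW m0) (ltW s0); have := mulr_ge0 (ltW m0) (ltW r0).
have := mulr_ge0 LB0 (ltW s0).
move: up; set l := (1 - r) * _; lra.
Qed.

(** Stationarity at the test function, divided by [sigma], gives mean 0 to an integrand that differs
    from [r - imbalance r z] by at most [sigma] times an integrable function; [sigma] then tends to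
    0 with [r] fixed. *)
Lemma mean_imbalance r (pi : probability (state S) R) : 0 < r < 1 -> invariant r pi ->
  pi.-integrable setT (EFin \o imbalance r) /\ \int[pi]_z imbalance r z = r.
Proof.
move=> r01 inv; have /andP[r0 r1] := r01.
have [Ci Ci0 CiP] := imbalance_le.
have [Cv Cv0 CvP] := arrival_variance_dist.
have [CY CY0 CYP] := total_workload_moment.
have [iY _] := CYP r pi r01 inv.
have eta0 z := imbalance_ge0 z r01.
have etaC z := CiP r z r01.
have ii : pi.-integrable setT (EFin \o imbalance r).
  apply: (@integrable_bounded _ _ _ _ _ Ci) => // z.
  by rewrite ger0_norm.
split=> //.
pose m := variance_constant; have m0 := variance_constant_gt0.
pose K := (Ci + 1) * \int[pi]_z total_workload z + (m + Cv * (Ci + 2)).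
have Y0 : 0 <= \int[pi]_z total_workload z.
  by apply: Rintegral_ge0 => z _; exact: total_workload_ge0.
have K0 : 0 <= K.
  by rewrite /K !addr_ge0 ?mulr_ge0 ?addr_ge0// ltW.
have id : pi.-integrable setT (EFin \o (fun z => r - imbalance r z)).
  apply: (@integrable_bounded _ _ _ _ _ (Ci + 1)) => // z.
  by rewrite ler_norml; have := eta0 z; have := etaC z; lra.
suff : \int[pi]_z (r - imbalance r z) = 0.
  have ir : pi.-integrable setT (EFin \o (fun _ : state S => r)).
    by apply: (@integrable_bounded _ _ _ _ _ `|r|).
  rewrite RintegralB// Rintegral_cst//= probability_setT mulr1; lra.
apply/eqP; rewrite -normr_eq0 eq_le normr_ge0 andbT.
apply/ler_addgt0Pr => e e0; rewrite add0r.
pose sigma := Num.min 1 (e / (K + 1)).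
have K1 : 0 < K + 1 by rewrite ltr_wpDl.
have s0 : 0 < sigma by rewrite lt_min ltr01 divr_gt0.
have s1 : sigma <= 1 by rewrite ge_min lexx.
have sK : sigma * K <= e.
  apply: (@le_trans _ _ (e / (K + 1) * K)).
    by rewrite ler_wpM2r// ge_min lexx orbT.
  by rewrite mulrAC ler_pdivrMr//; nra.
have F01 z := test_function_ge0_le1 z s0.
have F1 z : `|test_function sigma z| <= 1.
  by have /andP[F0 ?] := F01 z; rewrite ger0_norm.
have Av z : `|arrival_variance sigma r z| <= m + Cv * (Ci + 2).
  have := CvP sigma r z s0 r01.
  have : Cv * (imbalance r z + r + sigma) <= Cv * (Ci + 2).
    by rewrite ler_wpM2l//; have := etaC z; lra.
  rewrite -/m => h1 h2; rewrite -(subrK m (arrival_variance sigma r z)).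
  by apply: (le_trans (ler_normD _ _)); rewrite (gtr0_norm m0) -/m; lra.
pose g z := test_function sigma z * (r - imbalance r z + sigma * arrival_variance sigma r z).
have g0 : \int[pi]_z g z = 0.
  have := inv _ _ F1.
  under eq_Rintegral do rewrite gen_test_function//.
  rewrite RintegralZl//; last first.
    apply: (@integrable_bounded _ _ _ _ _ (Ci + 1 + (m + Cv * (Ci + 2)))) => // z.
    rewrite normrM -[leRHS]mul1r; apply: ler_pM => //.
    apply: (le_trans (ler_normD _ _)); apply: lerD.
      by rewrite ler_norml; have := eta0 z; have := etaC z; lra.
    by rewrite normrM (gtr0_norm s0) -[leRHS]mul1r ler_pM// ltW.
  by move=> /eqP; rewrite mulf_eq0 gt_eqF//= => /eqP.
have key z : `|(r - imbalance r z) - g z| <=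
    sigma * ((Ci + 1) * total_workload z + (m + Cv * (Ci + 2))).
  have -> : (r - imbalance r z) - g z =
    (1 - test_function sigma z) * (r - imbalance r z) -
    sigma * (test_function sigma z * arrival_variance sigma r z) by rewrite /g; ring.
  have /andP[F0 F1'] := F01 z.
  apply: (le_trans (ler_normB _ _)); rewrite [leRHS]mulrDr; apply: lerD.
    rewrite normrM ger0_norm ?subr_ge0// [leLHS]mulrC [leRHS]mulrCA; apply: ler_pM => //.
    - by rewrite subr_ge0.
    - by rewrite ler_norml; have := eta0 z; have := etaC z; lra.
    - exact: onem_test_function_le.
  rewrite normrM (gtr0_norm s0) ler_wpM2l ?(ltW s0)// normrM -[leRHS]mul1r.
  by apply: ler_pM.
have ig : pi.-integrable setT (EFin \o g).
  apply: (@integrable_bounded _ _ _ _ _ (Ci + 1 + (m + Cv * (Ci + 2)))) => // z.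
  rewrite normrM -[leRHS]mul1r; apply: ler_pM => //.
  apply: (le_trans (ler_normD _ _)); apply: lerD.
    by rewrite ler_norml; have := eta0 z; have := etaC z; lra.
  by rewrite normrM (gtr0_norm s0) -[leRHS]mul1r ler_pM// ltW.
have -> : \int[pi]_z (r - imbalance r z) = \int[pi]_z (r - imbalance r z - g z).
  by rewrite [RHS]RintegralB// g0 subr0.
apply: (le_trans (le_normr_Rintegral _ _)) => //; first exact: (integrableB _ id ig).
have iB : pi.-integrable setT (EFin \o (fun z => (Ci + 1) * total_workload z)).
  exact: (integrableZl _ (Ci + 1) iY).
have ic (c : R) : pi.-integrable setT (EFin \o (fun _ : state S => c)).
  by apply: (@integrable_bounded _ _ _ _ _ `|c|).
have iD : pi.-integrable setT
    (EFin \o (fun z => (Ci + 1) * total_workload z + (m + Cv * (Ci + 2)))).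
  exact: (integrableD _ iB (ic _)).
apply: (@le_trans _ _ (\int[pi]_z
    (sigma * ((Ci + 1) * total_workload z + (m + Cv * (Ci + 2)))))).
  apply: le_Rintegral => //.
  - exact: (integrable_norm (integrableB _ id ig)).
  - exact: (integrableZl _ sigma iD).
rewrite RintegralZl// RintegralD// RintegralZl// Rintegral_cst//=.
by rewrite probability_setT mulr1.
Qed.

Lemma Laplace_total_workload (s : R) : 0 < s -> exists r0 C : R, [/\ 0 < r0 <= 1, 0 <= C &
  forall r (pi : probability (state S) R), 0 < r < r0 -> invariant r pi ->
  `|(1 + s * variance_constant) * \int[pi]_z expR (- (s * r * total_workload z)) - 1|
    <= C * Num.sqrt r].
Proof.
move=> s0.
have [Ci Ci0 CiP] := imbalance_le.
have [Cv Cv0 CvP] := arrival_variance_dist.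
have [CY CY0 CYP] := total_workload_moment.
have [Cd Cd0 CdP] := imbalance_dispersion.
have [r0 [CT [r0_01 CT0 CTP]]] := dispersion_moment.
pose m := variance_constant; have m0 := variance_constant_gt0; rewrite -/m in m0 *.
pose B := \sum_a weight a.
have B0 : 0 <= B by apply: sumr_ge0 => b _; rewrite ltW// weight_gt0.
exists r0, (s * (Cd * (CT + Ci)) + s * (Cv * (2 + s)) + (1 + s * m) * (s ^+ 2 * B * CY)).
split=> //.
  by rewrite !addr_ge0// !mulr_ge0// ?addr_ge0 ?mulr_ge0 ?sqr_ge0 ?(ltW s0) ?(ltW m0).
move=> r pi rr inv; have /andP[r0_gt0 r0_le1] := r0_01; have /andP[rgt0 rlt] := rr.
have r01 : 0 < r < 1 by apply/andP; split; lra.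
have [iY YC] := CYP r pi r01 inv.
have [iT TC] := CTP r pi rr inv.
have [ii Ei] := mean_imbalance r01 inv.
have eta0 z := imbalance_ge0 z r01.
have etaC z := CiP r z r01.
have Y0 := total_workload_ge0.
have T0 := dispersion_ge0.
(* This [q] balances the two errors [q * CT] and [Ci * r / q] in the bound on the mean of dispersion
   times imbalance. *)
pose q := Num.sqrt r.
have q0 : 0 < q by rewrite sqrtr_gt0.
have qq : q ^+ 2 = r by rewrite sqr_sqrtr// ltW.
have q1 : q <= 1.
  by rewrite -sqrtr1 ler_wsqrtr//; lra.
have rq : r <= q by rewrite -qq expr2 ler_piMl// ltW.
pose sigma := s * r.
have sg0 : 0 < sigma by rewrite mulr_gt0.
pose F := test_function sigma.
have F01 z : 0 <= F z <= 1 := test_function_ge0_le1 z sg0.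
have F1 z : `|F z| <= 1.
  by have /andP[F0 ?] := F01 z; rewrite ger0_norm.
pose A := arrival_variance sigma r.
have Ad z : `|A z - m| <= Cv * (imbalance r z + r + sigma) := CvP sigma r z sg0 r01.
have bnd (f : state S -> R) (M : R) : (forall z, `|f z| <= M) ->
    pi.-integrable setT (EFin \o f).
  by move=> fM; apply: (@integrable_bounded _ _ _ _ _ M).
have ic (c : R) : pi.-integrable setT (EFin \o (fun _ : state S => c)).
  by apply: (bnd _ `|c|).
have iF : pi.-integrable setT (EFin \o F) := bnd _ _ F1.
have iFe : pi.-integrable setT (EFin \o (fun z => F z * imbalance r z)).
  apply: (bnd _ Ci) => z; rewrite normrM -[leRHS]mul1r ler_pM//.
  by rewrite ger0_norm.
have iFA : pi.-integrable setT (EFin \o (fun z => F z * (A z - m))).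
  apply: (bnd _ (Cv * (Ci + r + sigma))) => z; rewrite normrM -[leRHS]mul1r ler_pM//.
  by apply: le_trans (Ad z) _; rewrite ler_wpM2l// !lerD2r.
pose Lf := \int[pi]_z F z.
have stat : r * Lf - \int[pi]_z (F z * imbalance r z) + sigma * m * Lf +
    sigma * \int[pi]_z (F z * (A z - m)) = 0.
  have h1 : \int[pi]_z (sigma * (F z * (r - imbalance r z + sigma * A z))) = 0.
    have := inv _ _ F1; under eq_Rintegral do rewrite gen_test_function//.
    by [].
  have h2 : \int[pi]_z (sigma * (F z * (r - imbalance r z + sigma * A z))) =
      sigma * (r * Lf - \int[pi]_z (F z * imbalance r z) + sigma * m * Lf +
    sigma * \int[pi]_z (F z * (A z - m))).
    have i1 : pi.-integrable setT (EFin \o (fun z => r * F z)).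
      exact: (integrableZl _ r iF).
    have i2 : pi.-integrable setT (EFin \o (fun z => r * F z - F z * imbalance r z)).
      exact: (integrableB _ i1 iFe).
    have i3 : pi.-integrable setT (EFin \o (fun z => sigma * m * F z)).
      exact: (integrableZl _ (sigma * m) iF).
    have i4 : pi.-integrable setT (EFin \o (fun z => sigma * (F z * (A z - m)))).
      exact: (integrableZl _ sigma iFA).
    have i5 : pi.-integrable setT
       (EFin \o (fun z => r * F z - F z * imbalance r z + sigma * m * F z)).
      exact: (integrableD _ i2 i3).
    have i6 : pi.-integrable setT (EFin \o (fun z =>
        r * F z - F z * imbalance r z + sigma * m * F z + sigma * (F z * (A z - m)))).
      exact: (integrableD _ i5 i4).
    rewrite /Lf -!(RintegralZl _ measurableT iF) -(RintegralZl _ measurableT iFA).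
    rewrite -RintegralB// -!RintegralD// -RintegralZl//; apply: eq_Rintegral => z _; ring.
  move: h1; rewrite h2 => /eqP; rewrite mulf_eq0 gt_eqF//= => /eqP.
  exact.
have hA : `|\int[pi]_z (F z * (A z - m))| <= Cv * (2 * r + sigma).
  apply: (le_trans (le_normr_Rintegral _ _)) => //.
  have i1 : pi.-integrable setT (EFin \o (fun z => imbalance r z + (r + sigma))).
    exact: (integrableD _ ii (ic _)).
  have -> : Cv * (2 * r + sigma) = \int[pi]_z (Cv * (imbalance r z + (r + sigma))).
    rewrite RintegralZl// RintegralD// Ei.
    by rewrite Rintegral_cst//= probability_setT mulr1; ring.
  apply: le_Rintegral => //.
  - exact: (integrable_norm iFA).
  - exact: (integrableZl _ Cv i1).
  - move=> z _; rewrite normrM -[leRHS]mul1r ler_pM// addrA; exact: Ad.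
(* As the imbalance has mean [r], the difference is the mean of [(1 - F z) * imbalance r z]. Where
   the imbalance is nonzero, [1 - F z <= sigma * total_workload z <= sigma * Cd * dispersion z]. *)
have hE : 0 <= r - \int[pi]_z (F z * imbalance r z) <= sigma * (Cd * (q * (CT + Ci))).
  have -> : r - \int[pi]_z (F z * imbalance r z) =
      \int[pi]_z ((1 - F z) * imbalance r z).
    transitivity (\int[pi]_z imbalance r z - \int[pi]_z (F z * imbalance r z)).
      by rewrite Ei.
    by rewrite -RintegralB//; apply: eq_Rintegral => z _; ring.
  apply/andP; split.
    apply: Rintegral_ge0 => z _; rewrite mulr_ge0// subr_ge0.
    by have /andP[] := F01 z.
  have i1 : pi.-integrable setT (EFin \o (fun z => (1 - F z) * imbalance r z)).
    apply: (bnd _ Ci) => z; have /andP[F0 F1'] := F01 z.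
    rewrite normrM -[leRHS]mul1r ler_pM//; last by rewrite ger0_norm.
    by rewrite ger0_norm ?subr_ge0// gerBl.
  have i2 : pi.-integrable setT (EFin \o (fun z => q * dispersion z ^+ 2)).
    exact: (integrableZl _ q iT).
  have i3 : pi.-integrable setT (EFin \o (fun z => Ci / q * imbalance r z)).
    exact: (integrableZl _ (Ci / q) ii).
  have i4 : pi.-integrable setT
      (EFin \o (fun z => q * dispersion z ^+ 2 + Ci / q * imbalance r z)).
    exact: (integrableD _ i2 i3).
  apply: (@le_trans _ _ (\int[pi]_z (sigma * Cd *
      (q * dispersion z ^+ 2 + Ci / q * imbalance r z)))).
    apply: le_Rintegral => //; first exact: (integrableZl _ (sigma * Cd) i4).
    move=> z _; have [->|ne] := eqVneq (imbalance r z) 0.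
      rewrite !mulr0 addr0; apply: mulr_ge0; first by rewrite mulr_ge0// ltW.
      exact: mulr_ge0 (ltW q0) (sqr_ge0 _).
    apply: (@le_trans _ _ (sigma * Cd * (dispersion z * imbalance r z))).
      rewrite mulrA ler_wpM2r//.
      apply: le_trans (onem_test_function_le z sg0) _.
      by rewrite -mulrA ler_wpM2l ?(ltW sg0)//; exact: CdP ne.
    apply: ler_wpM2l; first by rewrite mulr_ge0// ltW.
    (* AM-GM: [T * eta <= q * T ^ 2 + eta ^ 2 / q] *)
    apply: (@le_trans _ _ (q * dispersion z ^+ 2 + imbalance r z ^+ 2 / q)).
      have -> : q * dispersion z ^+ 2 + imbalance r z ^+ 2 / q =
          (q * dispersion z - imbalance r z) ^+ 2 / q +
          2 * (dispersion z * imbalance r z) by field; rewrite gt_eqF.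
      have : 0 <= (q * dispersion z - imbalance r z) ^+ 2 / q.
        by rewrite divr_ge0 ?sqr_ge0// ltW.
      have : 0 <= dispersion z * imbalance r z by rewrite mulr_ge0.
      lra.
    rewrite lerD2l expr2 mulrAC; apply: ler_wpM2r => //.
    by apply: ler_wpM2r => //; rewrite invr_ge0 ltW.
  rewrite RintegralZl// RintegralD// !RintegralZl// Ei -[sigma * Cd * _]mulrA.
  rewrite ler_wpM2l ?(ltW sg0)// ler_wpM2l//.
  rewrite mulrDr lerD//; first by rewrite ler_wpM2l// ltW.
  by rewrite -{1}qq expr2 le_eqVlt; apply/orP; left; apply/eqP; field; rewrite gt_eqF.
have hL : `|(1 + s * m) * Lf - 1| <= s * (Cd * (CT + Ci)) * q + s * (Cv * (2 + s)) * q.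
  have E : r * ((1 + s * m) * Lf - 1) =
     - (r - \int[pi]_z (F z * imbalance r z)) - sigma * \int[pi]_z (F z * (A z - m)).
    by move: stat; rewrite /sigma; lra.
  rewrite -(ler_pM2l rgt0) -{1}(gtr0_norm rgt0) -normrM E -opprD normrN.
  apply: (le_trans (ler_normD _ _)); rewrite mulrDr; apply: lerD.
    have /andP[h1 h2] := hE; rewrite ger0_norm//; apply: (le_trans h2).
    by rewrite /sigma le_eqVlt; apply/orP; left; apply/eqP; ring.
  rewrite normrM (gtr0_norm sg0).
  apply: (le_trans (ler_wpM2l (ltW sg0) hA)); rewrite /sigma.
  have -> : s * r * (Cv * (2 * r + s * r)) = r * (s * (Cv * (2 + s)) * r) by ring.
  rewrite ler_wpM2l ?(ltW rgt0)//; apply: ler_wpM2l => //.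
  apply: mulr_ge0; first exact: ltW.
  by apply: mulr_ge0 => //; rewrite addr_ge0// ltW.
pose Le := \int[pi]_z expR (- (s * r * total_workload z)).
have ie : pi.-integrable setT (EFin \o (fun z => expR (- (s * r * total_workload z)))).
  apply: (bnd _ 1) => z; rewrite ger0_norm ?expR_ge0// -[leRHS]expR0 ler_expR oppr_le0.
  by rewrite mulr_ge0// mulr_ge0 ?ltW.
have hFe : `|Lf - Le| <= s ^+ 2 * B * CY * q.
  rewrite /Lf /Le -RintegralB//.
  apply: (le_trans (le_normr_Rintegral _ _)) => //; first exact: (integrableB _ iF ie).
  apply: (@le_trans _ _ (\int[pi]_z (sigma ^+ 2 * B * total_workload z))).
    apply: le_Rintegral => //.
    - exact: (integrable_norm (integrableB _ iF ie)).
    - exact: (integrableZl _ (sigma ^+ 2 * B) iY).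
    - by move=> z _; exact: test_function_exp.
  rewrite RintegralZl//.
  have -> : sigma ^+ 2 * B * \int[pi]_z total_workload z =
    s ^+ 2 * B * (r * (r * \int[pi]_z total_workload z)) by rewrite /sigma; ring.
  rewrite -[leRHS]mulrA; apply: ler_wpM2l; first by rewrite mulr_ge0 ?sqr_ge0.
  rewrite [leRHS]mulrC.
  have IY0 : 0 <= \int[pi]_z total_workload z by apply: Rintegral_ge0 => z _.
  by apply: ler_pM => //; rewrite ?mulr_ge0// ltW.
have sm0 : 0 <= 1 + s * m by rewrite addr_ge0// mulr_ge0// ltW.
rewrite -/Le; have -> : (1 + s * m) * Le - 1 = ((1 + s * m) * Lf - 1) - (1 + s * m) * (Lf - Le) by ring.
apply: (le_trans (ler_normB _ _)); rewrite normrM (ger0_norm sm0).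
have := ler_wpM2l sm0 hFe; rewrite -/q; lra.
Qed.

End estimates.

(** * Convergence in distribution *)

(** For large [y], or [x] far from the ray, the trivial bound [2 * M] is below one of the linear
    terms; otherwise uniform continuity near a compact segment applies. Linear growth lets first
    moments finish the estimate. *)
Lemma continuous_near_ray (R : realType) (n : nat) (f : 'rV[R]_n -> R)
    (w : 'rV[R]_n) (e : R) :
  continuous f -> bounded_fun f -> 0 < e ->
  exists2 K : R, 0 <= K & forall x y, 0 <= y ->
    `|f x - f (y *: w)| <= e * (1 + y) + K * \sum_k `|x ord0 k - y * w ord0 k|.
Proof.
move=> cf [M0 [_ fM0]] e0.
have [M M1 fM] : exists2 M : R, 0 < M & forall x, `|f x| <= M.
  exists (`|M0| + 1) => [|x]; first by rewrite ltr_wpDl.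
  by apply: (fM0 (`|M0| + 1)) => //; rewrite ltr_pwDr// ler_norm.
have fxy x y : `|f x - f y| <= 2 * M.
  apply: (le_trans (ler_normB _ _)); have := fM x; have := fM y; lra.
pose b := 2 * M / e.
pose C := (fun y : R => y *: w) @` `[0, b].
have cC : compact C.
  apply: continuous_compact; last exact: segment_compact.
  by apply: continuous_subspaceT; exact: scalel_continuous.
have [d d0 dP] := continuous_near_compact cf cC e0.
exists (2 * M / d); first by rewrite divr_ge0 ?mulr_ge0 ?ltW.
move=> x y y0; set D := \sum_k _.
have D0 : 0 <= D by exact: sumr_ge0.
have MD0 : 0 <= 2 * M / d * D by rewrite mulr_ge0// divr_ge0 ?mulr_ge0 ?ltW.
have [yb|yb] := leP y b; last first.
  move: yb; rewrite /b ltr_pdivrMr// => yb.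
  have := fxy x (y *: w); lra.
have [Dd|Dd] := ltP D d; last first.
  have : 2 * M <= 2 * M / d * D by rewrite mulrAC ler_pdivlMr// ler_pM2l// mulr_gt0.
  have := fxy x (y *: w); have := mulr_ge0 (ltW e0) y0; lra.
have : `|f x - f (y *: w)| <= e.
  apply: dP; first by exists y => //=; rewrite in_itv/= y0.
  split=> // i k; rewrite !ord1 mxE /ball/=; apply: le_lt_trans Dd.
  rewrite distrC /D (bigD1 k)//= lerDl; exact: sumr_ge0.
have := mulr_ge0 (ltW e0) y0; lra.
Qed.

Lemma integral_normr_exponential (R : realType) (d : measure_display)
    (T : measurableType d) (P : probability T R) (X : T -> R) (mean M : R)
    (g : R -> R) :
  measurable_fun setT X -> 0 < mean -> exponential_with_mean P X mean ->
  continuous g -> (forall x, `|g x| <= M) ->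
  \int[P]_w g `|X w| = \int[P]_w g (X w).
Proof.
move=> mX mean0 XE cg gM; rewrite /Rintegral; congr fine.
have mg := continuous_measurable_fun cg.
apply: ae_eq_integral => //.
- apply/measurable_EFinP; apply: measurableT_comp mg _.
  by apply: measurableT_comp.
- by apply/measurable_EFinP; exact: measurableT_comp.
- apply: filterS (exponential_with_mean_ae_ge0 mX mean0 XE) => w Xw _.
  by rewrite ger0_norm.
Qed.

Lemma stationary_invariant (R : realType) (nI nK : nat)
    (S : parallel_server_system R nI nK) (policy : state S -> activity S -> R)
    (r : R) (pi : probability (state S) R) :
  nonidling_policy policy -> 0 < r < 1 -> stationary_distribution policy r pi ->
  invariant policy r pi.
Proof.
move=> nonidling r01 stat f B fB.
apply: (@stationary_jump_generator _ _ _ _ _ _ total_rate _ _ _ _ _ f B) => //.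
- exact: transition_rate_ge0.
- exact: transition_rate_le.
- exact: total_rate_ge0.
- move=> t g t0 bg; have := stat t g t0 bg.
  by rewrite /transition_semigroup generatorE.
Qed.

Section weak_limit.
Context {R : realType} {nI nK : nat} {S : parallel_server_system R nI nK}.
Variables (v : 'I_nI -> R) (u : 'I_nK -> R).
Hypothesis rht : relaxed_heavy_traffic S.
Hypothesis rcrp : relaxed_complete_resource_pooling S.
Hypothesis dual : dual_optimal S v u.
Variable policy : state S -> activity S -> R.
Hypothesis nonidling : nonidling_policy policy.
Variable pi : R -> probability (state S) R.
Hypothesis pi_inv : forall r, 0 < r < 1 -> invariant policy r (pi r).

Let mean := (\sum_i arrival_rate S i * v i ^+ 2) / \sum_k u k ^+ 2.

Lemma limit_mean_gt0 : 0 < mean.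
Proof.
by rewrite divr_gt0 ?(variance_constant_gt0 rht rcrp dual) ?(norm2_gt0 rht rcrp dual).
Qed.

(* [`|r|] instead of [r] makes this nonnegative for every [r]. *)
Let xi (r : R) (z : state S) : R := `|r| * (total_workload u z / norm2 u).

Let xi_ge0 r z : 0 <= xi r z.
Proof.
rewrite mulr_ge0// divr_ge0 ?(total_workload_ge0 rht rcrp dual)//.
by rewrite ltW// (norm2_gt0 rht rcrp dual).
Qed.

Lemma cvg_Laplace_xi (s : R) : 0 < s ->
  \int[pi r]_z expR (- s * xi r z) @[r --> 0^'+] --> (1 + s * mean)^-1.
Proof.
move=> s0; have N0 := norm2_gt0 rht rcrp dual.
have sN0 : 0 < s / norm2 u by rewrite divr_gt0.
have [r0 [C [/andP[r00 r01] C0 CP]]] :=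
  Laplace_total_workload rht rcrp dual nonidling sN0.
have M0 : 0 < s * mean by rewrite mulr_gt0 ?limit_mean_gt0.
apply/cvgrPdist_le => e e0; near=> r.
have rgt0 : 0 < r by near: r; exact: nbhs_right_gt.
have rlt : r < r0 by near: r; exact: nbhs_right_lt.
have re : r < (e / (C + 1)) ^+ 2.
  by near: r; apply: nbhs_right_lt; rewrite exprn_gt0// divr_gt0// ltr_wpDl.
have rr : 0 < r < r0 by rewrite rgt0.
have r1 : 0 < r < 1 by apply/andP; split; lra.
have := CP r (pi r) rr (pi_inv r1).
have -> : \int[pi r]_z expR (- (s / norm2 u * r * total_workload u z)) =
    \int[pi r]_z expR (- s * xi r z).
  by apply: eq_Rintegral => z _; rewrite /xi gtr0_norm//; congr expR; ring.
have -> : s / norm2 u * variance_constant (S := S) v = s * mean.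
  by rewrite /mean /norm2 /variance_constant; ring.
set L := \int[_]_z _ => H.
have D0 : 0 < 1 + s * mean by rewrite addr_gt0.
have -> : (1 + s * mean)^-1 - L = (1 + s * mean)^-1 * - ((1 + s * mean) * L - 1).
  by field; rewrite gt_eqF.
rewrite normrM normrN gtr0_norm ?invr_gt0//.
apply: (@le_trans _ _ (C * Num.sqrt r)).
  apply: le_trans H; rewrite ler_piMl// invf_le1//; lra.
have : Num.sqrt r <= e / (C + 1).
  rewrite -[leRHS]ger0_norm ?divr_ge0 ?(ltW e0)//; last by rewrite addr_ge0.
  by rewrite -sqrtr_sqr ler_wsqrtr// ltW.
move=> /(ler_wpM2l C0) /le_trans; apply.
rewrite mulrCA ger_pMr// ler_pdivrMr ?ltr_wpDl//; lra.
Unshelve. all: by end_near. Qed.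

(** The scaled workload vector lies within [r * dispersion] of the point [xi r z] on the ray spanned
    by [u], and that distance vanishes in mean; along the ray the convergence is one-dimensional. *)
Lemma cvg_scaled_workload (d : measure_display) (T : measurableType d)
    (P : probability T R) (X : T -> R) (f : 'rV[R]_nK -> R) :
  measurable_fun setT X -> exponential_with_mean P X mean ->
  continuous f -> bounded_fun f ->
  \int[pi r]_z f (r *: (\row_k workload z k)) @[r --> 0^'+] -->
  \int[P]_w f (X w *: (\row_k u k)).
Proof.
move=> mX XE cf bf; have N0 := norm2_gt0 rht rcrp dual.
pose w : 'rV[R]_nK := \row_k u k.
pose g (y : R) := f (y *: w).
have cg : continuous g.
  by move=> y; apply: continuous_comp; [exact: scalel_continuous|exact: cf].
have [M0 [_ fM0]] := bf.
have fM x : `|f x| <= `|M0| + 1.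
  by apply: (fM0 (`|M0| + 1)) => //; rewrite ltr_pwDr// ler_norm.
have bg : bounded_fun g.
  exists (`|M0| + 1); split=> [|y My x _]; first exact: num_real.
  exact: le_trans (fM _) (ltW My).
have mY : measurable_fun setT (fun t => `|X t|) by exact: measurableT_comp.
have lim_g : \int[pi r]_z g (xi r z) @[r --> 0^'+] --> \int[P]_t g (X t).
  rewrite -(integral_normr_exponential mX limit_mean_gt0 XE cg (fun x => fM (x *: w))).
  apply: (@cvg_Laplace R R (0^'+) _ _ (fun=> state S) pi xi _ T P (fun t => `|X t|) mean) => //.
  - exact: cvg_Laplace_xi.
  - by move=> s s0; exact: Laplace_exponential mX limit_mean_gt0 s0 XE.
  - exact: limit_mean_gt0.
have [CY CY0 CYP] := total_workload_moment rht rcrp dual nonidling.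
have [r0 [CT [/andP[r00 r01] CT0 CTP]]] := dispersion_moment rht rcrp dual nonidling.
apply/cvgrPdist_le => e e0.
(* The mean of [1 + xi r z] is at most [1 + CY / norm2 u], so the error growing along the ray costs
   at most [e / 4]. *)
pose del := e / 4 / (1 + CY / norm2 u).
have D1 : 0 < 1 + CY / norm2 u by rewrite ltr_pwDl// divr_ge0// ltW.
have del0 : 0 < del by rewrite !divr_gt0.
have [K K0 KP] := continuous_near_ray w cf bf del0.
have e2 : 0 < e / 2 by lra.
have /cvgrPdist_le /(_ (e / 2) e2) near_g := lim_g.
have KCT1 : 0 < K * (1 + CT) + 1 by rewrite ltr_wpDl// mulr_ge0// addr_ge0.
near=> r.
have rgt0 : 0 < r by near: r; exact: nbhs_right_gt.
have rlt : r < r0 by near: r; exact: nbhs_right_lt.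
have re : r < e / 4 / (K * (1 + CT) + 1).
  by near: r; apply: nbhs_right_lt; rewrite !divr_gt0.
have rr : 0 < r < r0 by rewrite rgt0.
have r1 : 0 < r < 1 by apply/andP; split; lra.
have [iY YC] := CYP r (pi r) r1 (pi_inv r1).
have [iT TC] := CTP r (pi r) rr (pi_inv r1).
have gE : `|\int[P]_t g (X t) - \int[pi r]_z g (xi r z)| <= e / 2 by near: r.
have bnd (h : state S -> R) (M : R) : (forall z, `|h z| <= M) ->
    (pi r).-integrable setT (EFin \o h).
  by move=> hM; apply: (@integrable_bounded _ _ _ _ _ M).
have i1 : (pi r).-integrable setT (EFin \o (fun z => g (xi r z))).
  by apply: (bnd _ (`|M0| + 1)) => z; exact: fM.
have i2 : (pi r).-integrable setT (EFin \o (fun z => f (r *: (\row_k workload z k)))).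
  by apply: (bnd _ (`|M0| + 1)) => z; exact: fM.
pose a := r / norm2 u.
have ic1 : (pi r).-integrable setT (EFin \o (fun _ : state S => 1 : R)).
  by apply: (bnd _ 1) => z; rewrite normr1.
have i3 : (pi r).-integrable setT (EFin \o (fun z => 1 + a * total_workload u z)).
  exact: (integrableD _ ic1 (integrableZl _ a iY)).
have i4 : (pi r).-integrable setT (EFin \o (fun z => 1 + dispersion u z ^+ 2)).
  exact: (integrableD _ ic1 iT).
have i5 : (pi r).-integrable setT
    (EFin \o (fun z => del * (1 + a * total_workload u z))).
  exact: (integrableZl _ del i3).
have i6 : (pi r).-integrable setT
    (EFin \o (fun z => K * r * (1 + dispersion u z ^+ 2))).
  exact: (integrableZl _ (K * r) i4).
have xiE z : xi r z = a * total_workload u z.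
  by rewrite /xi /a gtr0_norm//; ring.
have pt z : `|f (r *: (\row_k workload z k)) - g (xi r z)| <=
    del * (1 + a * total_workload u z) + K * r * (1 + dispersion u z ^+ 2).
  apply: (le_trans (KP _ _ (xi_ge0 r z))); rewrite xiE lerD2l -mulrA ler_wpM2l//.
  have -> : \sum_k `|(r *: (\row_k0 workload z k0)) ord0 k -
      a * total_workload u z * w ord0 k| = r * dispersion u z.
    rewrite /dispersion [RHS]mulr_sumr; apply: eq_bigr => k _.
    transitivity `|r * deviation u z k|; last by rewrite normrM (gtr0_norm rgt0).
    by rewrite !mxE /deviation /a; congr (`|_|); ring.
  rewrite ler_pM2l//; have := sqr_ge0 (dispersion u z - 1).
  have := dispersion_ge0 u z; nra.
have diff : `|\int[pi r]_z f (r *: (\row_k workload z k)) -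
    \int[pi r]_z g (xi r z)| <= e / 2.
  rewrite -RintegralB//; apply: (le_trans (le_normr_Rintegral _ _)) => //.
    exact: (integrableB _ i2 i1).
  apply: (@le_trans _ _ (\int[pi r]_z (del * (1 + a * total_workload u z) +
      K * r * (1 + dispersion u z ^+ 2)))).
    apply: le_Rintegral => //; first exact: (integrable_norm (integrableB _ i2 i1)).
    exact: (integrableD _ i5 i6).
  have c1 : \int[pi r]_z 1 = 1 :> R.
    by rewrite Rintegral_cst//= probability_setT mulr1.
  have iaY : (pi r).-integrable setT (EFin \o (fun z => a * total_workload u z)).
    exact: (integrableZl _ a iY).
  rewrite RintegralD// !RintegralZl// !RintegralD// RintegralZl// c1.
  have h1 : a * \int[pi r]_z total_workload u z <= CY / norm2 u.
    by rewrite /a mulrAC ler_pM2r// invr_gt0.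
  have h2 : del * (1 + a * \int[pi r]_z total_workload u z) <= e / 4.
    apply: (@le_trans _ _ (del * (1 + CY / norm2 u))).
      by rewrite ler_wpM2l ?(ltW del0)// lerD2l.
    by rewrite /del divfK// gt_eqF.
  have h3 : K * r * (1 + \int[pi r]_z dispersion u z ^+ 2) <= e / 4.
    apply: (@le_trans _ _ (r * (K * (1 + CT)))).
      by rewrite [K * r]mulrC -mulrA ler_pM2l// ler_wpM2l// lerD2l.
    apply: (@le_trans _ _ (r * (K * (1 + CT) + 1))).
      by rewrite ler_pM2l// lerDl.
    by rewrite -ler_pdivlMr// ltW.
  lra.
move: gE diff; rewrite !ler_distl => /andP[? ?] /andP[? ?].
by apply/andP; split; lra.
Unshelve. all: by end_near. Qed.

End weak_limit.

Unset Implicit Arguments.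
Set Strict Implicit.
Set Printing Implicit Defensive.

Theorem theorem3p1 (R : realType) (nI nK : nat)
    (S : parallel_server_system R nI nK)
    (rht : relaxed_heavy_traffic S)
    (rcrp : relaxed_complete_resource_pooling S)
    (v : 'I_nI -> R) (u : 'I_nK -> R) (dual : dual_optimal S v u)
    (policy : state S -> activity S -> R)
    (nonidling : nonidling_policy policy)
    (d : R -> measure_display) (Omega : forall r : R, measurableType (d r))
    (P : forall r : R, probability (Omega r) R)
    (Z : forall r : R, {RV (P r) >-> state S})
    (stationary : forall r : R, 0 < r < 1 ->
       stationary_distribution policy r (distribution (P r) (Z r)))
    (d' : measure_display) (Omega' : measurableType d')
    (P' : probability Omega' R) (X : {RV P' >-> R})
    (exponential : exponential_with_mean P' X
       ((\sum_i arrival_rate S i * v i ^+ 2) / (\sum_k u k ^+ 2))) :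
  cvg_in_distribution (0^'+) P
    (fun r w => r *: (\row_k workload (Z r w) k))
    P' (fun w => X w *: (\row_k u k))
  /\
  (forall k : 'I_nK,
     cvg_in_distribution (0^'+) P (fun r w => r * workload (Z r w) k)
       P' (fun w => u k * X w) /\
     exponential_with_mean P' (fun w => u k * X w)
       (u k * ((\sum_i arrival_rate S i * v i ^+ 2) / (\sum_k u k ^+ 2)))).
Proof.
have M0 := limit_mean_gt0 rht rcrp dual.
have inv r : 0 < r < 1 -> invariant policy r (distribution (P r) (Z r)).
  by move=> r01; exact: stationary_invariant nonidling r01 (stationary r r01).
have mX : measurable_fun setT X by exact: measurable_funP.
have EP (r : R) (h : state S -> R) (M : R) : (forall z, `|h z| <= M) ->
    ('E_(P r)[fun w => h (Z r w)] = (\int[distribution (P r) (Z r)]_z h z)%:E)%E.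
  move=> hM; rewrite unlock.
  have ih : (P r).-integrable setT (EFin \o (fun w => h (Z r w))).
    apply: (@integrable_bounded _ _ _ _ _ M) => [|w]; last exact: hM.
    exact: measurableT_comp.
  rewrite /Rintegral fineK; last first.
    by apply: integrable_fin_num => //; apply: (@integrable_bounded _ _ _ _ _ M).
  by rewrite integral_distribution.
have cvgW : cvg_in_distribution (0^'+) P
    (fun r w => r *: (\row_k workload (Z r w) k)) P' (fun w => X w *: (\row_k u k)).
  move=> f cf bf; have [M1 [_ fM1]] := bf.
  have fM y : `|f y| <= `|M1| + 1.
    by apply: (fM1 (`|M1| + 1)) => //; rewrite ltr_pwDr// ler_norm.
  have -> : ('E_P'[fun w => f (X w *: (\row_k u k))] =
      (\int[P']_w f (X w *: (\row_k u k)))%:E)%E.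
    rewrite unlock /Rintegral fineK//; apply: integrable_fin_num => //.
    apply: (@integrable_bounded _ _ _ _ _ (`|M1| + 1)) => [|w]; last exact: fM.
    have cg : continuous (fun y : R => f (y *: (\row_k u k))).
      by move=> y; apply: continuous_comp; [exact: scalel_continuous|exact: cf].
    exact: measurableT_comp (continuous_measurable_fun cg) mX.
  rewrite (_ : (fun r => _) = EFin \o (fun r =>
      \int[distribution (P r) (Z r)]_z f (r *: (\row_k workload z k)))); last first.
    apply/funext => r /=.
    exact: (EP r (fun z => f (r *: (\row_k workload z k))) (`|M1| + 1) (fun z => fM _)).
  apply: cvg_EFin.
    exact: nearW.
  exact: (cvg_scaled_workload rht rcrp dual nonidling inv mX exponential cf bf).
split=> // k; split.
  move=> f cf bf.
  (* The marginal statement is the joint one applied to test functions of a single coordinate. *)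
  have cfk : continuous (fun y : 'rV[R]_nK => f (y ord0 k)).
    by move=> y; apply: continuous_comp; [exact: coord_continuous|exact: cf].
  have bfk : bounded_fun (fun y : 'rV[R]_nK => f (y ord0 k)).
    by case: bf => M1 [M1r H]; exists M1; split=> // y My z _; exact: H.
  have := cvgW _ cfk bfk.
  under eq_fun do under [X in expectation _ X]eq_fun do rewrite !mxE.
  under [X in _ --> _ X]eq_fun do rewrite !mxE mulrC.
  by [].
apply: exponential_with_mean_scale => //.
exact: (dual_gt0 rht dual rcrp).1.
Qed.
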